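(* Let $n \geq 2$ and let $\Omega \subset \mathbb{R}^n$ be a bounded Lipschitz domain. For $p\in(1,\infty)$ define $$C(\Omega,p) := \sup_{\substack{w \in W^{1,p}(\Omega),\ w\neq 0\\ \int_{\Omega} w \, \mathrm{d}x= 0}} \frac{\int_{\partial \Omega} |w|^p \, \mathrm{d}S}{\int_{\Omega}| \nabla w|^p \, \mathrm{d}x}.$$ (i) For $p\geq 2$ and $\alpha \in \left(\frac{-2^{2-p}}{p\, C(\Omega,p)}, 0 \right)$, $$\lambda_1(\alpha,p,n,\Omega) \geq \alpha \frac{|\partial \Omega|}{|\Omega|} \left(1+ 2^{p-2}(p-1)\left(\frac{2^{p-2} |\alpha| C(\Omega,p)}{1-2^{p-2}p\,C(\Omega,p)|\alpha|}\right)^{\frac{1}{p-1}} \right).$$ (ii) For $1 < p \leq 2$ and $\alpha \in \left(\frac{-1}{p\, C(\Omega,p)}, 0 \right)$, $$\lambda_1(\alpha,p,n,\Omega) \geq \alpha \frac{|\partial \Omega|}{|\Omega|} \left(1+ (p-1)\left(\frac{ |\alpha| C(\Omega,p)}{1-p\,C(\Omega,p)|\alpha|}\right)^{\frac{1}{p-1}} \right).$$ (iii) For $p=2$ and $\alpha \in \left(\frac{-1}{ C(\Omega,2)}, 0 \right)$ the stronger inequality $$\lambda_1(\alpha,2,n,\Omega) \geq \alpha \frac{|\partial \Omega|}{|\Omega|} \left(1+ \frac{ |\alpha| C(\Omega,2)}{1-C(\Omega,2)|\alpha|} \right)$$ holds.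
   Context: For $p\in(1,\infty)$, $\alpha\in\mathbb{R}$ and a bounded Lipschitz domain $\Omega\subset\mathbb{R}^n$, $$\lambda_1(\alpha, p,n, \Omega) := \inf_{u \in W^{1,p}(\Omega),\ u\neq 0} \frac{\int_{\Omega} | \nabla u|^{p} \, \mathrm{d}x + \alpha \int_{\partial \Omega} |u|^p \, \mathrm{d}S}{\int_{\Omega } |u|^p \, \mathrm{d}x},$$ where boundary values are understood in the sense of traces, $|\Omega|$ is the Lebesgue measure of $\Omega$ and $|\partial\Omega|$ is the surface measure of $\partial\Omega$. The constant $C(\Omega,p)$ is finite by the continuity of the trace operator $W^{1,p}(\Omega)\to L^p(\partial\Omega)$ and the Poincaré inequality. *)

(* Defs.v *)
From HB Require Import structures.
From mathcomp Require Import all_boot all_order all_algebra.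
From mathcomp Require Import all_classical all_reals all_analysis.

Set Implicit Arguments.
Unset Strict Implicit.
Unset Printing Implicit Defensive.

Import Order.TTheory GRing.Theory Num.Theory.
Import numFieldNormedType.Exports.

Local Open Scope classical_set_scope.
Local Open Scope ring_scope.

(* The library norm on 'rV[R]_n is the sup norm; lengths, diameters and norms
   of gradients below are Euclidean. *)
Definition enorm (R : realType) (n : nat) (x : 'rV[R]_n) : R :=
  Num.sqrt (\sum_(i < n) x ord0 i ^+ 2).

Definition edot (R : realType) (n : nat) (x y : 'rV[R]_n) : R :=
  \sum_(i < n) x ord0 i * y ord0 i.

(* Lebesgue measure and Hausdorff measures on R^n, as Caratheodory extensions
   of outer measures defined by countable covers. *)
Section CoverMeasures.
Context {R : realType}.
Local Open Scope ereal_scope.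

(* Every set is measurable in this type, so that [mu_ext c] below ranges over
   countable covers by arbitrary sets. *)
Definition discrete_type (n : nat) := g_sigma_algebraType [set: set 'rV[R]_n].

(* volume of the smallest closed box containing U, +oo if U is unbounded *)
Definition box_volume (n : nat) (U : set (discrete_type n)) : \bar R :=
  if U == set0 then 0 else
  ereal_inf [set (\prod_(i < n) (ab.2 ord0 i - ab.1 ord0 i))%:E | ab in
    [set ab : 'rV[R]_n * 'rV[R]_n |
      (forall i, (ab.1 ord0 i <= ab.2 ord0 i)%R) /\
      (forall x, U x -> forall i,
         (ab.1 ord0 i <= (x : 'rV[R]_n) ord0 i <= ab.2 ord0 i)%R)]].

Lemma box_volume0 n : @box_volume n set0 = 0.
Proof. by rewrite /box_volume eqxx. Qed.

Lemma box_volume_ge0 n (U : set (discrete_type n)) : 0 <= box_volume U.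
Proof.
rewrite /box_volume; case: ifPn => // _; apply: le_ereal_inf_tmp => _ [ab [ab_le _] <-].
by rewrite lee_fin prodr_ge0// => i _; rewrite subr_ge0.
Qed.

Definition lebesgue_outer (n : nat) : set 'rV[R]_n -> \bar R :=
  mu_ext (@box_volume n).

Lemma lebesgue_outer0 n : @lebesgue_outer n set0 = 0.
Proof. exact: (mu_ext0 (box_volume0 n) (@box_volume_ge0 n)). Qed.

Lemma lebesgue_outer_ge0 n (X : set 'rV[R]_n) : 0 <= lebesgue_outer X.
Proof. exact/mu_ext_ge0/box_volume_ge0. Qed.

Lemma le_lebesgue_outer n :
  {homo @lebesgue_outer n : A B / A `<=` B >-> A <= B}.
Proof. by move=> A B AB; exact: le_mu_ext. Qed.

Lemma lebesgue_outer_sigma_subadditive n :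
  sigma_subadditive (@lebesgue_outer n).
Proof. exact: (mu_ext_sigma_subadditive (@box_volume_ge0 n)). Qed.

HB.instance Definition _ (n : nat) := isOuterMeasure.Build R 'rV[R]_n
  (@lebesgue_outer n)
  (lebesgue_outer0 n) (@lebesgue_outer_ge0 n) (@le_lebesgue_outer n)
  (@lebesgue_outer_sigma_subadditive n).

Definition ediam (n : nat) (U : set 'rV[R]_n) : \bar R :=
  ereal_sup [set (enorm (xy.1 - xy.2))%:E | xy in [set xy | U xy.1 /\ U xy.2]].

Definition unit_ball_volume (m : nat) : \bar R :=
  lebesgue_outer [set x : 'rV[R]_m | (enorm x <= 1)%R].

Definition hausdorff_cost (n m : nat) (delta : R) (U : set (discrete_type n))
    : \bar R :=
  if U == set0 then 0
  else if ediam (U : set 'rV[R]_n) <= delta%:E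
  then unit_ball_volume m * (ediam (U : set 'rV[R]_n) / 2%:E) ^+ m
  else +oo.

Lemma hausdorff_cost0 n m delta : @hausdorff_cost n m delta set0 = 0.
Proof. by rewrite /hausdorff_cost eqxx. Qed.

Lemma hausdorff_cost_ge0 n m delta (U : set (discrete_type n)) :
  0 <= hausdorff_cost m delta U.
Proof.
rewrite /hausdorff_cost; case: ifPn => // /set0P[x Ux]; case: ifPn => // _.
rewrite mule_ge0 ?outer_measure_ge0// expe_ge0// mule_ge0//.
  apply: ereal_sup_ubound; exists (x, x) => //=.
  by rewrite subrr /enorm big1 ?sqrtr0// => i _; rewrite mxE expr0n.
by rewrite inve_ge0 lee_fin.
Qed.

(* Normalized so that the m-dimensional Hausdorff measure of a piece of an
   m-dimensional plane is its m-dimensional Lebesgue measure. *)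
Definition hausdorff_outer (n m : nat) (X : set 'rV[R]_n) : \bar R :=
  ereal_sup [set mu_ext (@hausdorff_cost n m delta) X |
             delta in [set delta : R | (0 < delta)%R]].

Lemma hausdorff_outer0 n m : @hausdorff_outer n m set0 = 0.
Proof.
apply/eqP; rewrite eq_le; apply/andP; split.
  apply: ge_ereal_sup => _ [d _ <-].
  by rewrite (mu_ext0 (hausdorff_cost0 n m d) (@hausdorff_cost_ge0 n m d)).
apply: ereal_sup_ubound; exists 1%R => //=.
by rewrite (mu_ext0 (hausdorff_cost0 n m 1) (@hausdorff_cost_ge0 n m 1)).
Qed.

Lemma hausdorff_outer_ge0 n m (X : set 'rV[R]_n) : 0 <= hausdorff_outer m X.
Proof.
apply: (@le_trans _ _ (mu_ext (@hausdorff_cost n m 1) X)).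
  exact/mu_ext_ge0/hausdorff_cost_ge0.
by apply: ereal_sup_ubound; exists 1%R => //=.
Qed.

Lemma le_hausdorff_outer n m :
  {homo @hausdorff_outer n m : A B / A `<=` B >-> A <= B}.
Proof.
move=> A B AB; apply: ge_ereal_sup => _ [d d0 <-].
apply: (@le_trans _ _ (mu_ext (hausdorff_cost m d) B)); first exact: le_mu_ext.
by apply: ereal_sup_ubound; exists d.
Qed.

Lemma hausdorff_outer_sigma_subadditive n m :
  sigma_subadditive (@hausdorff_outer n m).
Proof.
move=> F; apply: ge_ereal_sup => _ [d d0 <-].
apply: (le_trans (mu_ext_sigma_subadditive (@hausdorff_cost_ge0 n m d) _)).
apply: lee_nneseries => [k _ _|k _]; first exact/mu_ext_ge0/hausdorff_cost_ge0.
by apply: ereal_sup_ubound; exists d.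
Qed.

HB.instance Definition _ (n m : nat) := isOuterMeasure.Build R 'rV[R]_n
  (@hausdorff_outer n m) (hausdorff_outer0 n m) (@hausdorff_outer_ge0 n m)
  (@le_hausdorff_outer n m) (@hausdorff_outer_sigma_subadditive n m).

Definition lebesgue_om (n : nat) : {outer_measure set 'rV[R]_n -> \bar R} :=
  @lebesgue_outer n.

Definition hausdorff_om (n m : nat) : {outer_measure set 'rV[R]_n -> \bar R} :=
  @hausdorff_outer n m.

Definition lebesgue (n : nat) :
    {measure set (caratheodory_type (lebesgue_om n)) -> \bar R} :=
  lebesgue_om n.

Definition hausdorff (n m : nat) :
    {measure set (caratheodory_type (hausdorff_om n m)) -> \bar R} :=
  hausdorff_om n m.

(* The surface measure dS on the boundary of a Lipschitz domain is the
   restriction of the (n-1)-dimensional Hausdorff measure. *)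
Definition surface (n : nat) := hausdorff n n.-1.

End CoverMeasures.

Arguments lebesgue R n : clear implicits.
Arguments hausdorff R n m : clear implicits.
Arguments surface R n : clear implicits.

Section LipschitzDomains.
Context {R : realType} {n : nat}.
Implicit Types (Omega : set 'rV[R]_n).

Definition boundary Omega : set 'rV[R]_n := closure Omega `\` interior Omega.

(* Near each boundary point x, in an orthonormal frame with last axis nu, Omega
   is the region above the graph of a Lipschitz function of the coordinates
   orthogonal to nu. The sup norm underlying [ball] and [lipschitz] is
   equivalent to the Euclidean one. *)
Definition lipschitz_boundary Omega :=
  forall x, boundary Omega x ->
    exists (r : R) (nu : 'rV[R]_n) (gamma : 'rV[R]_n -> R),
      [/\ 0 < r, enorm nu = 1, lipschitz gamma &
          forall y, ball x r y ->
            (Omega y <-> gamma (y - edot y nu *: nu) < edot y nu)].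

Definition bounded_lipschitz_domain Omega :=
  [/\ Omega !=set0, open Omega, connected Omega, bounded_set Omega &
      lipschitz_boundary Omega].

End LipschitzDomains.

Section Sobolev.
Context {R : realType} {n : nat}.
Implicit Types (phi u g : 'rV[R]_n -> R) (G : 'rV[R]_n -> 'rV[R]_n).
Implicit Types (Omega : set 'rV[R]_n) (p alpha : R).

Definition partial (i : 'I_n) phi (x : 'rV[R]_n) : R :=
  'D_(delta_mx ord0 i) phi x.

Definition grad phi (x : 'rV[R]_n) : 'rV[R]_n := \row_i partial i phi x.

Fixpoint class_C (k : nat) phi : Prop :=
  if k is k'.+1 then
    continuous phi /\
    forall i, (forall x, derivable phi x (delta_mx ord0 i)) /\
              class_C k' (partial i phi)
  else continuous phi.

Definition smooth phi := forall k, class_C k phi.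

Definition test_function Omega phi :=
  smooth phi /\
  exists K : set 'rV[R]_n,
    [/\ compact K, K `<=` Omega & forall x, ~ K x -> phi x = 0].

Local Open Scope ereal_scope.

Definition in_Lp d (T : measurableType d) (mu : {measure set T -> \bar R})
    (D : set T) p (f : T -> R) :=
  measurable_fun D f /\ \int[mu]_(x in D) ((`|f x| `^ p)%R)%:E < +oo.

Definition weak_gradient Omega u G :=
  forall (phi : 'rV[R]_n -> R) (i : 'I_n), test_function Omega phi ->
    \int[lebesgue R n]_(x in Omega) (u x * partial i phi x)%:E =
    - \int[lebesgue R n]_(x in Omega) (G x ord0 i * phi x)%:E.

(* u belongs to W^{1,p}(Omega) and G represents its weak gradient *)
Definition sobolev p Omega u G :=
  [/\ in_Lp (lebesgue R n) Omega p u,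
      forall i, in_Lp (lebesgue R n) Omega p (fun x => G x ord0 i) &
      weak_gradient Omega u G].

(* The trace operator W^{1,p}(Omega) -> L^p(boundary) is the continuous
   extension of the restriction of functions smooth up to the boundary; it is
   given here by its graph: g represents the trace of u, whose weak gradient is
   G. *)
Definition trace p Omega u G g :=
  in_Lp (surface R n) (boundary Omega) p g /\
  exists phi : nat -> 'rV[R]_n -> R,
    [/\ forall k, smooth (phi k),
        (fun k => \int[lebesgue R n]_(x in Omega)
           ((`|phi k x - u x| `^ p)%R)%:E) @ \oo --> 0,
        (fun k => \int[lebesgue R n]_(x in Omega)
           ((enorm (grad (phi k) x - G x) `^ p)%R)%:E) @ \oo --> 0 &
        (fun k => \int[surface R n]_(x in boundary Omega)
           ((`|phi k x - g x| `^ p)%R)%:E) @ \oo --> 0].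

Definition sobolev_trace p Omega u G g :=
  sobolev p Omega u G /\ trace p Omega u G g.

Definition ae_zero Omega u :=
  {ae lebesgue R n, forall x, Omega x -> u x = 0%R}.

Definition power_integral p Omega u : \bar R :=
  \int[lebesgue R n]_(x in Omega) ((`|u x| `^ p)%R)%:E.

Definition gradient_integral p Omega G : \bar R :=
  \int[lebesgue R n]_(x in Omega) ((enorm (G x) `^ p)%R)%:E.

Definition boundary_integral p Omega g : \bar R :=
  \int[surface R n]_(x in boundary Omega) ((`|g x| `^ p)%R)%:E.

(* Quantifying over representatives: the weak gradient G and the trace g are
   determined by u up to null sets. *)
Definition lambda1 alpha p Omega : \bar R :=
  ereal_inf [set q | exists u G g,
    [/\ sobolev_trace p Omega u G g, ~ ae_zero Omega u &
        q = (gradient_integral p Omega G + alpha%:E * boundary_integral p Omega g)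
            / power_integral p Omega u]].

Definition trace_constant p Omega : \bar R :=
  ereal_sup [set q | exists w G g,
    [/\ sobolev_trace p Omega w G g, ~ ae_zero Omega w,
        \int[lebesgue R n]_(x in Omega) (w x)%:E = 0 &
        q = boundary_integral p Omega g / gradient_integral p Omega G]].

End Sobolev.

(* Main.v *)
(* A function u with mean value c over Omega is written u = c + w. An elementary
   inequality, derived from Young's inequality, gives for every eps > 0
     |c + w|^p <= (1 + A eps) |c|^p + (D + k eps^(1-p)) |w|^p,
   with (A, D, k) depending only on p. Integrating it over the boundary, bounding
   the w-term by C(Omega, p) times the gradient integral and choosing eps so that
   this term is absorbed by the gradient integral leaves
   alpha (1 + A eps) |c|^p |boundary|, and |c|^p |Omega| <= \int |u|^p by
   convexity. Since C(Omega, p) < +oo follows from the bounds on alpha, neither the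
   trace theorem nor the Poincare inequality is needed; that constants have weak
   gradient 0 comes from the translation invariance of the Lebesgue measure. *)

Require Import Defs.
From HB Require Import structures.
From mathcomp Require Import all_boot all_order all_algebra.
From mathcomp Require Import all_classical all_reals all_analysis.
From mathcomp Require Import measurable_realfun.
From mathcomp Require Import ring lra.

Set Implicit Arguments.
Unset Strict Implicit.
Unset Printing Implicit Defensive.

Import Order.TTheory GRing.Theory Num.Theory.
Import numFieldNormedType.Exports.

Local Open Scope classical_set_scope.
Local Open Scope ring_scope.

(** * Pointwise inequalities *)

(** The parts differ only in the triple (A, D, k). Convexity gives (a + b)^p <= a^p + p b (a +
    b)^(p-1), and (a + b)^(p-1) <= k (a^(p-1) + b^(p-1)) with k = 2^(p-2) by convexity for p >= 2
    and k = 1 by subadditivity for p <= 2. Young's inequality on the mixed term b a^(p-1) then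
    yields A = k (p - 1) and D = k p. For p = 2 expanding the square directly gives D = 1, whence
    the wider range of alpha in (iii). When C > 0, the eps in the bounds solves |alpha| C (D + k
    eps^(1-p)) = 1, which is possible exactly when D |alpha| C < 1. The obstacle is that both
    measures are Caratheodory measures of outer measures built from covers, while comparing and
    adding integrals requires measurable sets and integrands. Open sets and continuous functions are
    therefore shown measurable for both measures, and this is reduced to coordinate half-spaces: for
    Lebesgue measure by cutting boxes, for Hausdorff measures by additivity on separated sets. *)

Section RealInequalities.
Context {R : realType}.
Implicit Types (a b p r eps A D k : R).

(** The graph of the p-th power lies above its tangent at a. For p > 1 this is Young's inequality
    for a^(p-1) and b with exponents p/(p-1) and p; for p = 1 the first exponent degenerates and
    both sides are b. *)
Lemma powR_tangent p a b : 1 <= p -> 0 <= a -> 0 <= b ->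
  p * a `^ (p - 1) * b <= (p - 1) * a `^ p + b `^ p.
Proof.
rewrite le_eqVlt => /predU1P[<- a0 b0|p1 a0 b0].
  by rewrite subrr powRr0 !mul1r mul0r add0r powRr1.
have p0 : 0 < p by lra.
have q0 : 0 < p / (p - 1) by rewrite divr_gt0// subr_gt0.
have := @conjugate_powR R (a `^ (p - 1)) b (p / (p - 1)) p (powR_ge0 _ _) b0 q0 p0.
have -> : (p / (p - 1))^-1 + p^-1 = 1 by field; rewrite gt_eqF// subr_eq0 gt_eqF.
move=> /(_ erefl); rewrite -powRrM mulrCA divff ?mulr1; last by rewrite subr_eq0 gt_eqF.
rewrite -(ler_pM2l p0) mulrA => /le_trans; apply.
rewrite le_eqVlt; apply/orP; left; apply/eqP; field.
by rewrite gt_eqF// subr_eq0 gt_eqF.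
Qed.

(** Scaling of [powR_tangent]: with d = eps^(1/p), replace a by d a and b by d^(1-p) b. The weights
    cancel on the left, and their p-th powers are eps and eps^(1-p). *)
Lemma powR_young eps p a b : 0 < eps -> 1 <= p -> 0 <= a -> 0 <= b ->
  p * a `^ (p - 1) * b <= (p - 1) * eps * a `^ p + eps `^ (1 - p) * b `^ p.
Proof.
move=> e0 p1 a0 b0; have p0 : p != 0 by rewrite gt_eqF// (lt_le_trans _ p1).
set d := eps `^ p^-1; have d0 : 0 < d by exact: powR_gt0.
have dp : d `^ p = eps by rewrite /d -powRrM mulVf// powRr1// ltW.
have dr x : d `^ x != 0 by rewrite gt_eqF// powR_gt0.
have := @powR_tangent p (d * a) (d `^ (1 - p) * b) p1.
rewrite !mulr_ge0 ?powR_ge0// ?(ltW d0)// => /(_ isT isT).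
rewrite !powRM ?powR_ge0 ?(ltW d0)//.
have -> : (d `^ (1 - p)) `^ p = eps `^ (1 - p) by rewrite -powRrM mulrC powRrM dp.
have dd : d `^ (p - 1) * d `^ (1 - p) = 1.
  by rewrite -powRD ?(gt_eqF d0) ?implybT// addrA subrK subrr powRr0.
have -> : p * (d `^ (p - 1) * a `^ (p - 1)) * (d `^ (1 - p) * b) =
   p * a `^ (p - 1) * b * (d `^ (p - 1) * d `^ (1 - p)) by ring.
by rewrite dd mulr1 dp mulrA.
Qed.

(** The shares a/(a+b) and b/(a+b) lie in [0, 1] and add up to 1, and a share is at most its own
    r-th power because r <= 1. *)
Lemma powR_subadditive r a b : 0 <= r -> r <= 1 -> 0 <= a -> 0 <= b ->
  (a + b) `^ r <= a `^ r + b `^ r.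
Proof.
move=> r0 r1 a0 b0; have [s0|s0] := leP (a + b) 0.
  have -> : a = 0 by lra.
  by rewrite add0r lerDr powR_ge0.
have H x : 0 <= x -> x <= a + b -> x / (a + b) * (a + b) `^ r <= x `^ r.
  move=> x0 xs; have [->|x_neq0] := eqVneq x 0; first by rewrite mul0r mul0r powR_ge0.
  rewrite -[in leRHS](divfK (lt0r_neq0 s0) x) powRM ?divr_ge0 ?(ltW s0)//.
  rewrite ler_wpM2r ?powR_ge0// ger1_powR// ler_pdivrMr// mul1r xs andbT.
  by rewrite divr_gt0// lt_def x_neq0.
apply: le_trans (lerD (H a _ _) (H b _ _)) => //; [|lra|lra].
by rewrite -mulrDl -mulrDl divff ?mul1r// lt0r_neq0.
Qed.

(** Sum of the tangent inequalities at the midpoint [s], taken at a and at b: the linear terms add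
    up to 2 r s^r. *)
Lemma powR_sum_le_convex r a b : 1 <= r -> 0 <= a -> 0 <= b ->
  (a + b) `^ r <= 2 `^ (r - 1) * (a `^ r + b `^ r).
Proof.
move=> r1 a0 b0; pose s := (a + b) / 2.
have s0 : 0 <= s by rewrite divr_ge0// addr_ge0.
have ha := @powR_tangent r s a r1 s0 a0; have hb := @powR_tangent r s b r1 s0 b0.
have r0 : 0 < r by lra.
have hs : s `^ (r - 1) * s = s `^ r by rewrite mulrC mulr_powRB1.
have h2 : 2 * 2 `^ (r - 1) = 2 `^ r :> R by rewrite mulr_powRB1.
have ab : a + b = 2 * s by rewrite /s; field.
have -> : (a + b) `^ r = 2 `^ (r - 1) * (2 * s `^ r).
  by rewrite ab powRM// -h2; ring.
rewrite ler_wpM2l ?powR_ge0//.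
have : r * s `^ (r - 1) * a + r * s `^ (r - 1) * b = 2 * r * s `^ r.
  by rewrite -mulrDr ab -hs; ring.
lra.
Qed.

(* The one-parameter family of inequalities that bounds |c + w|^p by |c|^p and
   |w|^p; each part of the theorem is obtained from one triple (A, D, k). *)
Definition powR_split p A D k := [/\ 0 <= A, 0 <= D, 0 < k &
  forall eps a b, 0 < eps -> 0 <= a -> 0 <= b ->
  (a + b) `^ p <= (1 + A * eps) * a `^ p + (D + k * eps `^ (1 - p)) * b `^ p].

(** The tangent at a + b, evaluated at a, gives (a + b)^p <= a^p + p b (a + b)^(p-1). The hypothesis
    splits the last power into k p b^p, which is the D-term, and the mixed term k p a^(p-1) b, to
    which [powR_young] applies. *)
Lemma powR_split_of_sum p k : 1 < p -> 0 < k ->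
  (forall a b, 0 <= a -> 0 <= b ->
     (a + b) `^ (p - 1) <= k * (a `^ (p - 1) + b `^ (p - 1))) ->
  powR_split p (k * (p - 1)) (k * p) k.
Proof.
move=> p1 k0 sum_le; split=> [| | //|eps a b e0 a0 b0].
- by rewrite mulr_ge0 ?(ltW k0)//; lra.
- by rewrite mulr_ge0 ?(ltW k0)//; lra.
have p0 : 0 < p by lra.
have ab0 : 0 <= a + b by exact: addr_ge0.
have h1 := @powR_tangent p (a + b) a (ltW p1) ab0 a0.
have h2 := sum_le a b a0 b0.
have h3 := @powR_young eps p a b e0 (ltW p1) a0 b0.
have hb : b * b `^ (p - 1) = b `^ p by rewrite mulr_powRB1.
have hab : (a + b) * (a + b) `^ (p - 1) = (a + b) `^ p by rewrite mulr_powRB1.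
have h4 : p * b * (a + b) `^ (p - 1) <= p * b * (k * (a `^ (p - 1) + b `^ (p - 1))).
  by rewrite ler_wpM2l// mulr_ge0// ltW.
have := ler_wpM2l (ltW k0) h3.
move: h4 h1; rewrite -hb -hab.
set X := (a + b) `^ (p - 1); set Y := a `^ (p - 1); set Z := b `^ (p - 1).
set E := eps `^ _; set W := a `^ p.
move=> h4 h1 h5.
have : p * b * (k * (Y + Z)) = k * (p * Y * b) + k * p * (b * Z) by ring.
by lra.
Qed.

Lemma powR_split_ge2 p : 2 <= p ->
  powR_split p (2 `^ (p - 2) * (p - 1)) (2 `^ (p - 2) * p) (2 `^ (p - 2)).
Proof.
move=> p2; apply: powR_split_of_sum; [by lra|by rewrite powR_gt0|].
move=> a b a0 b0; have -> : p - 2 = p - 1 - 1 by ring.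
by apply: powR_sum_le_convex => //; lra.
Qed.

Lemma powR_split_le2 p : 1 < p -> p <= 2 -> powR_split p (p - 1) p 1.
Proof.
move=> p1 p2; rewrite -[X in powR_split _ X]mul1r -[X in powR_split _ _ X]mul1r.
apply: powR_split_of_sum => // a b a0 b0; rewrite mul1r.
by apply: powR_subadditive => //; lra.
Qed.

(** Here 2 a b <= eps a^2 + b^2 / eps comes from (eps a - b)^2 >= 0. The gain over [powR_split_le2]
    at p = 2 is D = 1 instead of D = 2. *)
Lemma powR_split2 : powR_split 2 1 1 1.
Proof.
split=> // eps a b e0 a0 b0; rewrite !powR_mulrn ?addr_ge0//.
have -> : 1 - 2 = -1 :> R by ring.
rewrite powR_inv1 ?(ltW e0)// !mul1r.
have : 0 <= (eps * a - b) ^+ 2 / eps by rewrite divr_ge0 ?sqr_ge0// ltW.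
have -> : (eps * a - b) ^+ 2 / eps = eps * a ^+ 2 - 2 * a * b + eps^-1 * b ^+ 2.
  by field; rewrite gt_eqF.
have -> : (a + b) ^+ 2 = a ^+ 2 + 2 * a * b + b ^+ 2 by ring.
lra.
Qed.

(** Serves where only finiteness or convergence matters and the size of the constants does not. *)
Lemma powR_split_exists p : 1 < p -> exists A D k, powR_split p A D k.
Proof.
move=> p1; have [p2|p2] := leP p 2.
  by exists (p - 1), p, 1; exact: powR_split_le2.
by exists (2 `^ (p - 2) * (p - 1)), (2 `^ (p - 2) * p), (2 `^ (p - 2));
  apply: powR_split_ge2; exact: ltW.
Qed.

End RealInequalities.

(** * Measurability of half-spaces *)

Section CoverMeasurability.
Context {R : realType}.
Local Open Scope ereal_scope.

(** Cutting every member of a cover of X by P and by Q gives covers of the two parts; the cost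
    inequality is then summed over the members. *)
Lemma mu_ext_split d (T : semiRingOfSetsType d) (c : set T -> \bar R) (P Q : set T) :
  (forall U, 0 <= c U) -> (forall U : set T, measurable U) ->
  (forall U, c (U `&` P) + c (U `&` Q) <= c U) ->
  forall X, mu_ext c (X `&` P) + mu_ext c (X `&` Q) <= mu_ext c X.
Proof.
move=> c0 mT cPQ X; apply: le_ereal_inf_tmp => _ [F [mF XF] <-].
have cover S : mu_ext c (X `&` S) <= \sum_(k <oo) c (F k `&` S).
  apply: ereal_inf_lbound; exists (fun k => F k `&` S) => //; split => //.
  by rewrite -setI_bigcupl; exact: setSI.
apply: le_trans (leeD (cover P) (cover Q)) _.
rewrite -nneseriesD//; apply: lee_nneseries => [k _ _|k _]; last exact: cPQ.
by rewrite adde_ge0.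
Qed.

Lemma mu_ext_le_cost d (T : semiRingOfSetsType d) (c : set T -> \bar R) (X : set T) :
  c set0 = 0 -> (forall U, 0 <= c U) -> measurable X -> mu_ext c X <= c X.
Proof.
move=> c00 c0 mX; apply: ereal_inf_lbound.
exists (fun k => if k is 0%N then X else set0).
  by split=> [[|k]//|x Xx]; exists 0%N.
by rewrite nneseries_recl// eseries0 ?adde0// => -[|k].
Qed.

Lemma discrete_measurable n (U : set (discrete_type n)) :
  measurable (U : set (@discrete_type R n)).
Proof. exact: sub_gen_smallest. Qed.

Definition halfspace n (i : 'I_n) (c : R) : set 'rV[R]_n :=
  [set x | (x ord0 i < c)%R].

Lemma box_volume_le n (U : set (@discrete_type R n)) (a b : 'rV[R]_n) :
  (forall i, (a ord0 i <= b ord0 i)%R) ->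
  (forall x, U x -> forall i, (a ord0 i <= (x : 'rV[R]_n) ord0 i <= b ord0 i)%R) ->
  box_volume U <= (\prod_(i < n) (b ord0 i - a ord0 i))%:E.
Proof.
move=> ab Uab; rewrite /box_volume; case: ifPn => [_|_].
  by rewrite lee_fin prodr_ge0// => i _; rewrite subr_ge0.
by apply: ereal_inf_lbound; exists (a, b).
Qed.

(** The hyperplane x_i = c cuts a closed box into two boxes with a common face, whose volumes add up
    to the volume of the box. *)
Lemma box_volume_split n (i : 'I_n) (c : R) (U : set (@discrete_type R n)) :
  box_volume (U `&` halfspace i c) + box_volume (U `&` ~` halfspace i c)
  <= box_volume U.
Proof.
set E := halfspace i c.
have [UE0|/set0P[x [Ux Ex]]] := eqVneq (U `&` E) set0.
  rewrite UE0 box_volume0 add0e setIidl//.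
  by move=> x Ux Ex; have : (U `&` E) x by []; rewrite UE0.
have [UE0|/set0P[y [Uy Ey]]] := eqVneq (U `&` ~` E) set0.
  rewrite UE0 box_volume0 adde0 setIidl// => z Uz; apply: contrapT => nEz.
  by have : (U `&` ~` E) z by []; rewrite UE0.
rewrite [leRHS]/box_volume ifF; last by apply/negbTE/set0P; exists x.
apply: le_ereal_inf_tmp => _ [[a b] /= [ab Uab] <-].
have /andP[ax xb] := Uab _ Ux i; have /andP[ay yb] := Uab _ Uy i.
move: Ey; rewrite /E/halfspace/= => /negP; rewrite -leNgt => cy.
have ac : (a ord0 i <= c)%R by rewrite (le_trans ax)// ltW.
have cb : (c <= b ord0 i)%R by exact: le_trans yb.
(* Since U has points on both sides, c lies between the i-th coordinates of a and b. The lower piece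
   is [a, b'] and the upper piece is [a', b]. *)
pose a' : 'rV[R]_n := \row_j if j == i then c else a ord0 j.
pose b' : 'rV[R]_n := \row_j if j == i then c else b ord0 j.
have UE : box_volume (U `&` E) <= (\prod_(j < n) (b' ord0 j - a ord0 j))%:E.
  apply: box_volume_le => [j|z [Uz Ez] j]; rewrite mxE; case: eqP => [->|_] //.
    by have /andP[-> _] := Uab _ Uz i; rewrite ltW.
  exact: Uab.
have UEc : box_volume (U `&` ~` E) <= (\prod_(j < n) (b ord0 j - a' ord0 j))%:E.
  apply: box_volume_le => [j|z [Uz /negP]]; first by rewrite mxE; case: eqP => [->|].
  rewrite -leNgt => Ez j; rewrite mxE; case: eqP => [->|_]; last exact: Uab.
  by have /andP[_ ->] := Uab _ Uz i; rewrite andbT.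
apply: le_trans (leeD UE UEc) _; rewrite -EFinD lee_fin.
rewrite (bigD1 i)//= [X in (_ + X <= _)%R](bigD1 i)//= [leRHS](bigD1 i)//=.
rewrite !mxE eqxx.
rewrite (eq_bigr (fun j => b ord0 j - a ord0 j)%R); last first.
  by move=> j /negbTE ji; rewrite !mxE ji.
rewrite [X in (_ + _ * X <= _)%R](eq_bigr (fun j => b ord0 j - a ord0 j)%R); last first.
  by move=> j /negbTE ji; rewrite !mxE ji.
by rewrite -mulrDl addrC addrA subrK.
Qed.

Lemma lebesgue_halfspace_measurable n (i : 'I_n) (c : R) :
  (lebesgue_om n).-cara.-measurable (halfspace i c).
Proof.
apply: le_caratheodory_measurable => X; apply: mu_ext_split.
- exact: box_volume_ge0.
- exact: discrete_measurable.
- exact: box_volume_split.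
Qed.

(** * Hausdorff measures: additivity on separated sets and half-spaces *)

Lemma expe_le (x y : \bar R) m : 0 <= x -> x <= y -> x ^+ m <= y ^+ m.
Proof.
move=> x0 xy; elim: m => [|m ih]; first by rewrite !expe0.
by rewrite !expeS lee_pmul// expe_ge0.
Qed.

Lemma ediam_ge0 n (U : set 'rV[R]_n) x : U x -> 0 <= ediam U.
Proof.
move=> Ux; apply: ereal_sup_ubound; exists (x, x) => //=.
by rewrite subrr /enorm big1 ?sqrtr0// => i _; rewrite mxE expr0n.
Qed.

Lemma ediam_le n (U V : set 'rV[R]_n) : U `<=` V -> ediam U <= ediam V.
Proof.
move=> UV; apply: ge_ereal_sup => _ [[x y] [/= Ux Uy] <-].
by apply: ereal_sup_ubound; exists (x, y) => //; split; exact: UV.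
Qed.

Lemma hausdorff_cost_le n m delta (U V : set (@discrete_type R n)) :
  U `<=` V -> hausdorff_cost m delta U <= hausdorff_cost m delta V.
Proof.
move=> UV; rewrite {1}/hausdorff_cost; case: ifPn => [_|/set0P[x Ux]].
  exact: hausdorff_cost_ge0.
rewrite /hausdorff_cost [leRHS]ifF; last by apply/negbTE/set0P; exists x; exact: UV.
have := ediam_le UV.
have [dV dUV|_ _] := leP (ediam (V : set 'rV[R]_n)) delta%:E; last exact: leey.
rewrite (le_trans dUV dV) lee_wpmul2l ?outer_measure_ge0// expe_le//.
  by rewrite mule_ge0 ?inve_ge0 ?lee_fin//; exact: ediam_ge0 Ux.
by rewrite lee_wpmul2r// inve_ge0 lee_fin.
Qed.

Lemma hausdorff_cost_anti n m (delta delta' : R) (U : set (@discrete_type R n)) :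
  (delta <= delta')%R -> hausdorff_cost m delta' U <= hausdorff_cost m delta U.
Proof.
move=> dd; rewrite /hausdorff_cost; case: ifPn => // _.
have [dU|_] := leP (ediam (U : set 'rV[R]_n)) delta%:E; last exact: leey.
by rewrite (le_trans dU)// lee_fin.
Qed.

Lemma enorm_ge_coord n (x : 'rV[R]_n) i : (`|x ord0 i| <= enorm x)%R.
Proof.
rewrite -sqrtr_sqr ler_sqrt ?sumr_ge0// => [|j _]; last exact: sqr_ge0.
by rewrite (bigD1 i)//= lerDl sumr_ge0// => j _; exact: sqr_ge0.
Qed.

(** A set that meets both P and Q has diameter at least e > delta, so its cost is +oo. Otherwise one
    piece is empty and monotonicity suffices. *)
Lemma hausdorff_cost_split n m (i : 'I_n) (delta e : R) (P Q : set 'rV[R]_n)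
    (U : set (@discrete_type R n)) : (delta < e)%R ->
  (forall x y, P x -> Q y -> (e <= `|x ord0 i - y ord0 i|)%R) ->
  hausdorff_cost m delta (U `&` P) + hausdorff_cost m delta (U `&` Q)
  <= hausdorff_cost m delta U.
Proof.
move=> de PQ; have [UP0|/set0P[x [Ux Px]]] := eqVneq (U `&` P) set0.
  by rewrite UP0 hausdorff_cost0 add0e hausdorff_cost_le.
have [UQ0|/set0P[y [Uy Qy]]] := eqVneq (U `&` Q) set0.
  by rewrite UQ0 hausdorff_cost0 adde0 hausdorff_cost_le.
rewrite [leRHS]/hausdorff_cost ifF; last by apply/negbTE/set0P; exists x.
rewrite ifF ?leey//; apply/negbTE; rewrite -ltNge (@lt_le_trans _ _ e%:E) ?lte_fin//.
apply: (@le_trans _ _ (enorm ((x : 'rV[R]_n) - y))%:E).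
  rewrite lee_fin (le_trans (PQ _ _ Px Qy))//.
  by have := enorm_ge_coord ((x : 'rV[R]_n) - y) i; rewrite !mxE.
by apply: ereal_sup_ubound; exists (x, y).
Qed.

(** For M = +oo nothing is claimed. Otherwise every member is at most M, hence finite, and terms may
    be moved across the inequality. *)
Lemma ereal_supD_le (S T : set (\bar R)) M : S !=set0 -> T !=set0 ->
  (forall x, S x -> 0 <= x) -> (forall y, T y -> 0 <= y) ->
  (forall x y, S x -> T y -> x + y <= M) -> ereal_sup S + ereal_sup T <= M.
Proof.
move=> [x0 Sx0] [y0 Ty0] S0 T0 STM.
have M0 : 0 <= M.
  by apply: le_trans (STM _ _ Sx0 Ty0); rewrite adde_ge0 ?(S0 _ Sx0) ?(T0 _ Ty0).
case: M M0 STM => [M| |] // M0 STM; last exact: leey.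
have Tfin y : T y -> y \is a fin_num.
  move=> Ty; rewrite ge0_fin_numE ?(T0 _ Ty)// (@le_lt_trans _ _ M%:E) ?ltry//.
  by rewrite (le_trans _ (STM _ _ Sx0 Ty))// leeDr// (S0 _ Sx0).
have supS y : T y -> ereal_sup S + y <= M%:E.
  move=> Ty; rewrite -leeBrDr ?Tfin//; apply: ge_ereal_sup => x Sx.
  by rewrite leeBrDr ?Tfin// STM.
have Sge0 : 0 <= ereal_sup S by rewrite (le_trans (S0 _ Sx0))//; exact: ereal_sup_ubound.
have Sfin : ereal_sup S \is a fin_num.
  rewrite ge0_fin_numE// (@le_lt_trans _ _ M%:E) ?ltry//.
  by rewrite (le_trans _ (supS _ Ty0))// leeDl// (T0 _ Ty0).
rewrite addeC -leeBrDr//; apply: ge_ereal_sup => y Ty.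
by rewrite leeBrDr// addeC supS.
Qed.

(** The two values on the left are suprema over independent scales d1 and d2. Costs grow as the
    scale shrinks, so both may be replaced by one scale below e, at which no cover member of finite
    cost meets both P and Q. *)
Lemma hausdorff_separated n m (i : 'I_n) (e : R) (P Q X : set 'rV[R]_n) : (0 < e)%R ->
  (forall x y, P x -> Q y -> (e <= `|x ord0 i - y ord0 i|)%R) ->
  hausdorff_outer m (X `&` P) + hausdorff_outer m (X `&` Q) <= hausdorff_outer m X.
Proof.
move=> e0 PQ; apply: ereal_supD_le.
- by exists (mu_ext (@hausdorff_cost R n m 1) (X `&` P)); exists 1%R; rewrite //= ltr01.
- by exists (mu_ext (@hausdorff_cost R n m 1) (X `&` Q)); exists 1%R; rewrite //= ltr01.
- by move=> _ [d _ <-]; exact/mu_ext_ge0/hausdorff_cost_ge0.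
- by move=> _ [d _ <-]; exact/mu_ext_ge0/hausdorff_cost_ge0.
move=> _ _ [d1 /= d10 <-] [d2 /= d20 <-].
pose d : R := Num.min (Num.min d1 d2) (e / 2)%R.
have d0 : (0 < d)%R by rewrite !lt_min d10 d20 divr_gt0.
have anti d' Y : (d <= d')%R ->
    mu_ext (@hausdorff_cost R n m d') Y <= mu_ext (@hausdorff_cost R n m d) Y.
  move=> dd'; apply: le_ereal_inf_tmp => _ [F FY <-].
  apply: (@le_trans _ _ (\sum_(k <oo) hausdorff_cost m d' (F k))).
    by apply: ereal_inf_lbound; exists F.
  apply: lee_nneseries => [k _ _|k _]; first exact: hausdorff_cost_ge0.
  exact: hausdorff_cost_anti.
have dd1 : (d <= d1)%R by rewrite !ge_min lexx.
have dd2 : (d <= d2)%R by rewrite !ge_min lexx orbT.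
have de : (d < e)%R by rewrite gt_min ltr_pdivrMr// mulr_natr mulr2n ltrDl e0 orbT.
apply: le_trans (leeD (anti _ _ dd1) (anti _ _ dd2)) _.
apply: (@le_trans _ _ (mu_ext (@hausdorff_cost R n m d) X)); last first.
  by apply: ereal_sup_ubound; exists d.
apply: mu_ext_split => [U|U|U]; first exact: hausdorff_cost_ge0.
  exact: discrete_measurable.
exact: hausdorff_cost_split PQ.
Qed.

(* Caratheodory's criterion: the slabs R k of the half-space that shrink
   towards its boundary hyperplane have summable measure, because slabs whose
   indices differ by at least 2 are separated. *)
Lemma hausdorff_halfspace_measurable n m (i : 'I_n) (c : R) :
  (hausdorff_om n m).-cara.-measurable (halfspace i c).
Proof.
apply: le_caratheodory_measurable => X.
pose H : set 'rV[R]_n -> \bar R := hausdorff_outer m.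
change (H (X `&` halfspace i c) + H (X `&` ~` halfspace i c) <= H X).
have H0 Y : 0 <= H Y by exact: hausdorff_outer_ge0.
have le_H Y Z : Y `<=` Z -> H Y <= H Z by exact: le_hausdorff_outer.
have [XE|] := leP +oo (H X); first by rewrite (le_trans (leey _)).
move=> HX.
pose t k : R := (c - k.+1%:R^-1)%R.
have tS k : (t k < t k.+1)%R.
  by rewrite /t ltrD2l ltrN2 ltf_pV2 ?posrE ?ltr0n// ltr_nat.
have t_mono j k : (j <= k)%N -> (t j <= t k)%R.
  by move=> jk; rewrite /t lerD2l lerN2 lef_pV2 ?posrE ?ltr0n// ler_nat.
pose A k := X `&` [set x | (x ord0 i <= t k)%R].
pose S k := X `&` [set x | (t k < x ord0 i <= t k.+1)%R].
(* One invariant treats even and odd slabs together: [S N.+1] is separated from [A N] by the slab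
   [S N], so these two merge into [A N.+2], while the term for [A N.+1] is carried over. *)
have sum_le N : \sum_(k < N) H (S k) <= H (A N) + H (A N.-1).
  elim: N => [|N ih]; first by rewrite big_ord0 adde_ge0.
  rewrite big_ord_recr/=.
  have SA : H (S N) <= H (A N.+1).
    by apply: le_H => x [Xx /andP[_ ?]].
  case: N ih SA => [|N] ih SA; first by rewrite big_ord0 add0e (le_trans SA)// leeDl.
  apply: le_trans (leeD2r _ ih) _; rewrite -addeA addeC leeD2r//.
  set Y := A N.+2.
  have -> : A N.+1.-1 = Y `&` [set x | (x ord0 i <= t N)%R].
    rewrite /Y/A/= -setIA; congr (_ `&` _); apply/seteqP; split=> [x/=xt|x []]//.
    by split=> //; apply: le_trans xt _; apply: t_mono; rewrite ltnW.
  have -> : S N.+1 = Y `&` [set x | (t N.+1 < x ord0 i)%R].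
    rewrite /Y/A/S -setIA; congr (_ `&` _); apply/seteqP.
    by split=> [x/=/andP[]|x /=[-> ->]].
  apply: (@hausdorff_separated _ _ i (t N.+1 - t N)%R); first by rewrite subr_gt0.
  by move=> x y /= xt yt; rewrite distrC ger0_norm; have := tS N; lra.
have A_le k : H (A k) <= H X by apply: le_H => x [].
have S_sum : \sum_(k <oo) H (S k) < +oo.
  apply: (@le_lt_trans _ _ (H X + H X)); last by rewrite lte_add_pinfty.
  apply: lime_le; first exact: is_cvg_nneseries.
  by apply: nearW => N; rewrite big_mkord (le_trans (sum_le N))// leeD.
have tail := nneseries_tail_cvg S_sum (fun k _ => H0 (S k)).
apply/lee_addgt0Pr => e e0.
have : \forall N \near \oo, \sum_(N <= k <oo) H (S k) <= e%:E.
  near=> N; apply: ltW; near: N.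
  have : nbhs (0 : \bar R) [set y | y < e%:E].
    by apply: open_nbhs_nbhs; split; [exact: open_ereal_lt_ereal|rewrite /= lte_fin].
  by move=> /tail.
move=> [N _ /(_ N (leqnn N)) tailN].
have XE : H (X `&` halfspace i c) <= H (A N) + \sum_(N <= k <oo) H (S k).
  apply: (@le_trans _ _ (H (A N `|` \bigcup_(k in ~` `I_N) S k))).
    apply: le_H => x [Xx xc]; have [xN|Nx] := leP (x ord0 i) (t N).
      by left.
    right.
    have [k kx] : exists k, (x ord0 i <= t k)%R.
      have cx : (0 < c - x ord0 i)%R by rewrite subr_gt0.
      have [k _ /(_ k (leqnn k)) hk] := near_infty_natSinv_lt (PosNum cx).
      by exists k; rewrite /t lerBrDr addrC -lerBrDr ltW.
    have ex : exists k, (x ord0 i <= t k)%R by exists k.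
    (* The least index with x_i <= t k is a successor l + 1 because x lies beyond t N; by minimality
       x belongs to the slab [S l], and l >= N. *)
    case: (ex_minnP ex) => -[|l] xl lmin.
      by have := lt_le_trans Nx xl; rewrite ltNge t_mono.
    exists l.
      by rewrite /= => lN; have := lt_le_trans Nx xl; rewrite ltNge t_mono.
    split=> //=; rewrite xl andbT ltNge; apply/negP => /lmin.
    by rewrite ltnn.
  apply: le_trans (@outer_measureU2 _ _ (hausdorff_om n m) _ _) _.
  apply: leeD => //; exact: (@outer_measure_sigma_subadditive_tail _ _ (hausdorff_om n m)).
apply: (@le_trans _ _ (H (A N) + H (X `&` ~` halfspace i c) + e%:E)).
  rewrite -addeA [X in _ <= _ + X]addeC addeA leeD2r//.
  by apply: le_trans XE _; rewrite leeD2l.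
(* [A N] keeps the distance 1/(N+1) from the complement of the half-space; the slabs lost by passing
   to [A N] cost at most e. *)
rewrite leeD2r//; apply: (@hausdorff_separated _ _ i N.+1%:R^-1%R) => //.
move=> x y /= xt /negP; rewrite -leNgt => cy.
have : (0 < N.+1%:R^-1 :> R)%R by [].
move: xt cy; rewrite /t; set v := _^-1%R => xt cy v0.
by rewrite distrC ger0_norm; lra.
Unshelve. all: by end_near. Qed.

End CoverMeasurability.

(** * Borel sets and translations *)

(** The pushforward of [mu] along [t] agrees with [mu] on measurable sets, so the change of
    variables formula applies. *)
Lemma integral_measure_preserving {R : realType} d (T : measurableType d)
    (mu : {measure set T -> \bar R}) (t : T -> T) (f : T -> R) :
  measurable_fun setT t -> (forall A, measurable A -> mu (t @^-1` A) = mu A) ->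
  mu.-integrable setT (EFin \o f) ->
  (\int[mu]_x (f (t x))%:E = \int[mu]_x (f x)%:E)%E.
Proof.
move=> mt tmu fi; have mf := measurable_int _ fi.
have pushE (g : T -> \bar R) :
    (\int[pushforward mu t]_x g x = \int[mu]_x g x)%E.
  by apply: eq_measure_integral => A mA _; exact: tmu.
have fti : mu.-integrable setT ((EFin \o f) \o t).
  apply/integrableP; split; first exact: measurableT_comp mf mt.
  have /integrableP[_] := fi; apply: le_lt_trans.
  rewrite -[leRHS]pushE (@ge0_integral_pushforward _ _ _ _ _ _ mt mu setT)//.
  by apply: measurableT_comp => //; exact: mf.
rewrite -[RHS](pushE (EFin \o f)).
by rewrite (@integral_pushforward _ _ _ _ _ _ mt mu setT (EFin \o f)).
Qed.

Section EuclideanMeasurability.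
Context {R : realType} {n : nat}.

(** An open set is the countable union of the half-open boxes with rational centre and radius
    1/(k+1) that it contains. *)
Lemma open_halfspaces_measurable (mu : {outer_measure set 'rV[R]_n -> \bar R})
    (U : set 'rV[R]_n) :
  (forall i c, mu.-cara.-measurable (halfspace i c)) -> open U ->
  mu.-cara.-measurable U.
Proof.
move=> mh oU.
pose box (qk : 'rV[rat]_n * nat) : set 'rV[R]_n := \bigcap_i
  (halfspace i (ratr (qk.1 ord0 i) + qk.2.+1%:R^-1) `&`
   ~` halfspace i (ratr (qk.1 ord0 i) - qk.2.+1%:R^-1)).
have mbox qk : mu.-cara.-measurable (box qk).
  rewrite -(setCK (box qk)); apply: measurableC; rewrite setC_bigcap.
  apply: countable_bigcupT_measurable; first exact: countableP.
  move=> i; apply: measurableC; apply: measurableI; first exact: mh.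
  apply: measurableC; exact: mh.
pose F qk := if `[< box qk `<=` U >] then box qk else set0.
have -> : U = \bigcup_qk F qk.
  apply/seteqP; split; last first.
    by move=> x [qk _]; rewrite /F; case: asboolP => // + bx; exact.
  move=> x Ux; have /nbhs_ballP[e /= e0 eU] : nbhs x U by exact: open_nbhs_nbhs.
  (* The centre is within r of x and the box has radius r, so its points are within 2 r < e of x. *)
  have e20 : 0 < e / 2 by rewrite divr_gt0.
  have [k _ /(_ k (leqnn k)) /= hk] := near_infty_natSinv_lt (PosNum e20).
  set r : R := k.+1%:R^-1 in hk; have r0 : 0 < r by rewrite /r invr_gt0.
  have [q qP] : {q : 'rV[rat]_n & forall i, ratr (q ord0 i) \in `](x ord0 i - r), (x ord0 i + r)[}.
    have /choice[q qP] : forall i, exists q, ratr q \in `](x ord0 i - r), (x ord0 i + r)[.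
      move=> i; have xr : x ord0 i - r < x ord0 i + r by lra.
      by have [q qP] := rat_in_itvoo xr; exists q.
    by exists (\row_i q i) => i; rewrite mxE.
  exists (q, k) => //; rewrite /F; case: asboolP => [_|]; last first.
    case=> y yb; apply: eU; split => // i j; rewrite ord1.
    have [+ /negP] := yb j I; rewrite /halfspace/= -/r -leNgt => y1 y2.
    have := qP j; rewrite in_itv/= => /andP[q1 q2].
    rewrite /ball/= ltr_distl; apply/andP; split; lra.
  move=> i _; have := qP i; rewrite in_itv/= => /andP[q1 q2].
  rewrite /halfspace/= -/r; split; first lra.
  by apply/negP; rewrite -leNgt; lra.
apply: countable_bigcupT_measurable; first exact: countableP.
by move=> qk; rewrite /F; case: ifP => // _; exact: mbox.
Qed.

Lemma continuous_halfspaces_measurable (mu : {outer_measure set 'rV[R]_n -> \bar R})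
    (f : 'rV[R]_n -> R) (D : set 'rV[R]_n) :
  (forall i c, mu.-cara.-measurable (halfspace i c)) -> continuous f ->
  measurable_fun (D : set (caratheodory_type mu)) f.
Proof.
move=> mh cf; apply: (@measurable_funS _ _ _ _ setT) => //.
move=> mT; apply: (measurability _ (RGenOpens.measurableE R)).
move=> _ [_ [a [b ->] <-]]; rewrite setTI.
apply: open_halfspaces_measurable => //.
by apply: open_comp => [x _|]; [exact: cf|exact: interval_open].
exact: mT.
Qed.

Lemma open_lebesgue_measurable (U : set 'rV[R]_n) : open U ->
  (lebesgue_om n).-cara.-measurable U.
Proof.
by apply: open_halfspaces_measurable => i c; exact: lebesgue_halfspace_measurable.
Qed.

Lemma boundary_surface_measurable (Omega : set 'rV[R]_n) :
  (hausdorff_om n n.-1).-cara.-measurable (boundary Omega).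
Proof.
have oM (U : set 'rV[R]_n) : open U -> (hausdorff_om n n.-1).-cara.-measurable U.
  by apply: open_halfspaces_measurable => i c; exact: hausdorff_halfspace_measurable.
rewrite /boundary setDE; apply: measurableI.
  rewrite -(setCK (closure Omega)); apply: measurableC; apply: oM.
  by rewrite openC; exact: closed_closure.
by apply: measurableC; apply: oM; exact: open_interior.
Qed.

Lemma continuous_lebesgue_measurable (f : 'rV[R]_n -> R) D : continuous f ->
  measurable_fun (D : set (caratheodory_type (lebesgue_om n))) f.
Proof.
apply: continuous_halfspaces_measurable => i c; exact: lebesgue_halfspace_measurable.
Qed.

Lemma continuous_surface_measurable (f : 'rV[R]_n -> R) D : continuous f ->
  measurable_fun (D : set (caratheodory_type (hausdorff_om n n.-1))) f.
Proof.
apply: continuous_halfspaces_measurable => i c; exact: hausdorff_halfspace_measurable.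
Qed.

Lemma lebesgue_bounded_lty (A : set 'rV[R]_n) : bounded_set A ->
  (lebesgue R n A < +oo)%E.
Proof.
move=> [M [Mreal]] /(_ (`|M| + 1)).
have MM : M < `|M| + 1 by rewrite (le_lt_trans (ler_norm M))// ltrDl.
move=> /(_ MM) AM; set b := `|M| + 1 in AM *.
have b0 : 0 <= b by rewrite /b addr_ge0.
apply: (@le_lt_trans _ _ (box_volume (A : set (discrete_type n)))).
  apply: mu_ext_le_cost; [exact: box_volume0|exact: box_volume_ge0|].
  exact: discrete_measurable.
apply: (le_lt_trans (@box_volume_le R n A (const_mx (- b)) (const_mx b) _ _)).
- by move=> i; rewrite !mxE ge0_cp.
- move=> x Ax i; rewrite !mxE -ler_norml (le_trans _ (AM _ Ax))//.
  by rewrite [leRHS]mx_normrE; apply: le_trans (le_bigmax _ _ (ord0, i)).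
- exact: ltry.
Qed.

Definition translate (h x : 'rV[R]_n) : 'rV[R]_n := x + h.

(** A box [a, b] around U gives the box [a - h, b - h] of the same volume. The reverse inequality is
    obtained for outer measures in [lebesgue_translate], from the shift by [- h]. *)
Lemma box_volume_translate h (U : set 'rV[R]_n) :
  (box_volume (translate h @^-1` U : set (discrete_type n)) <=
   box_volume (U : set (discrete_type n)))%E.
Proof.
have [->|/set0P[x Ux]] := eqVneq U set0; first by rewrite preimage_set0 box_volume0.
rewrite [leRHS]/box_volume ifF; last by apply/negbTE/set0P; exists x.
apply: le_ereal_inf_tmp => _ [[a b] /= [ab Uab] <-].
rewrite (eq_bigr (fun i => (b - h) ord0 i - (a - h) ord0 i)); last first.
  by move=> i _; rewrite !mxE; ring.
apply: box_volume_le => [i|y Uy i]; first by rewrite !mxE lerD2r.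
by have := Uab _ Uy i; rewrite /translate !mxE lerBlDr lerBrDr.
Qed.

Lemma lebesgue_translate_le h (A : set 'rV[R]_n) :
  (lebesgue_outer (translate h @^-1` A) <= lebesgue_outer A)%E.
Proof.
apply: le_ereal_inf_tmp => _ [F [_ AF] <-].
apply: (@le_trans _ _ (\sum_(k <oo)
    box_volume (translate h @^-1` F k : set (discrete_type n)))%E).
  apply: ereal_inf_lbound; exists (fun k => translate h @^-1` F k) => //.
  split=> [k|x /AF[k _ Fk]]; first exact: discrete_measurable.
  by exists k.
apply: lee_nneseries => [k _ _|k _]; first exact: box_volume_ge0.
exact: box_volume_translate.
Qed.

Lemma translateK h (A : set 'rV[R]_n) :
  translate (- h) @^-1` (translate h @^-1` A) = A.
Proof. by apply/seteqP; split=> x; rewrite /translate /preimage/= subrK. Qed.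

Lemma lebesgue_translate h (A : set 'rV[R]_n) :
  lebesgue_outer (translate h @^-1` A) = lebesgue_outer A.
Proof.
apply/eqP; rewrite eq_le lebesgue_translate_le/=.
rewrite -[X in (lebesgue_outer X <= _)%E](translateK h).
exact: lebesgue_translate_le.
Qed.

(** The Caratheodory criterion for the preimage of A on a test set X is the criterion for A on the
    translate of X, because the outer measure is invariant. *)
Lemma measurable_translate h :
  measurable_fun setT (translate h : caratheodory_type (lebesgue_om n) ->
                                     caratheodory_type (lebesgue_om n)).
Proof.
move=> _ A mA; rewrite setTI; apply: le_caratheodory_measurable => X.
have E B : lebesgue_outer B = lebesgue_outer (translate (- h) @^-1` B).
  by rewrite lebesgue_translate.
have EC : translate (- h) @^-1` (~` (translate h @^-1` A)) = ~` A.
  by apply/seteqP; split=> x; rewrite /translate /preimage/= subrK.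
rewrite [X in (X + _ <= _)%E]E [X in (_ + X <= _)%E]E [leRHS]E.
rewrite [X in (lebesgue_outer X + _ <= _)%E]preimage_setI.
rewrite [X in (_ + lebesgue_outer X <= _)%E]preimage_setI EC translateK.
by rewrite [leRHS](mA (translate (- h) @^-1` X)).
Qed.

Lemma integral_translate h (f : 'rV[R]_n -> R) :
  (lebesgue R n).-integrable setT (EFin \o f) ->
  (\int[lebesgue R n]_x (f (x + h))%:E = \int[lebesgue R n]_x (f x)%:E)%E.
Proof.
move=> fi; apply: (@integral_measure_preserving _ _ _ (lebesgue R n) (translate h)).
- exact: measurable_translate.
- by move=> A mA; exact: lebesgue_translate.
- exact: fi.
Qed.

End EuclideanMeasurability.

(** * Integrals of partial derivatives *)

Section TestFunctions.
Context {R : realType} {n : nat}.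
Implicit Types (phi : 'rV[R]_n -> R) (K Omega : set 'rV[R]_n).

Lemma partial_eq0 i phi K x : closed K -> (forall y, ~ K y -> phi y = 0) ->
  ~ K x -> partial i phi x = 0.
Proof.
move=> cK phi0 Kx; rewrite /partial (@near_eq_derive _ _ _ phi (cst 0)) ?derive_cst//.
have oK : open (~` K) by rewrite openC.
near=> y; apply: phi0; near: y.
by apply: open_nbhs_nbhs; split.
Unshelve. all: by end_near. Qed.

Lemma continuous_compact_support_bounded phi K : continuous phi -> compact K ->
  (forall y, ~ K y -> phi y = 0) -> exists2 M, 0 <= M & forall x, `|phi x| <= M.
Proof.
move=> cphi cK phi0.
have [M [Mreal]] := compact_bounded (continuous_compact (continuous_subspaceT cphi) cK).
have MM : M < `|M| + 1 by rewrite (le_lt_trans (ler_norm M))// ltrDl.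
move=> /(_ _ MM) KM; exists (`|M| + 1); first by rewrite addr_ge0.
move=> x; have [Kx|/phi0->] := pselect (K x); last by rewrite normr0 addr_ge0.
by apply: KM; exists x.
Qed.

(** Mean value theorem along the i-th axis. It bounds all difference quotients by the same M, as
    dominated convergence requires. *)
Lemma increment_le i phi M : continuous phi ->
  (forall x, derivable phi x (delta_mx ord0 i)) ->
  (forall x, `|partial i phi x| <= M) ->
  forall (x : 'rV[R]_n) (h : R), 0 <= h -> `|phi (x + h *: delta_mx ord0 i) - phi x| <= M * h.
Proof.
move=> cphi dphi phiM x h h0; set e := delta_mx ord0 i.
pose g (t : R) : R := phi (x + t *: e).
have dg (t : R) : is_derive t (1 : R) g (partial i phi (x + t *: e)).
  have E : (fun s : R => s^-1 *: ((g \o shift t) (s *: (1 : R)) - g t)) =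
      (fun s => s^-1 *: ((phi \o shift (x + t *: e)) (s *: e) - phi (x + t *: e))).
    by apply/funext => s; rewrite /g/= [s *: 1]mulr1 scalerDl addrCA.
  by apply: DeriveDef; rewrite /derivable /derive E//; exact: dphi.
have [|c _] := @MVT_segment R g (fun t => partial i phi (x + t *: e)) 0 h h0
    (fun t _ => dg t).
  apply: continuous_subspaceT => t; apply: continuous_comp; last exact: cphi.
  by apply: cvgD; [exact: cvg_cst|apply: cvgZr_tmp; exact: cvg_id].
rewrite /g scale0r addr0 subr0 => ->; rewrite normrM (ger0_norm h0).
by rewrite ler_wpM2r.
Qed.

Lemma integrable_bounded_support phi A M : (lebesgue_om n).-cara.-measurable A ->
  (lebesgue R n A < +oo)%E ->
  measurable_fun setT (phi : caratheodory_type (lebesgue_om n) -> R) ->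
  (forall x, `|phi x| <= M) -> (forall x, ~ A x -> phi x = 0) ->
  (lebesgue R n).-integrable setT (EFin \o phi).
Proof.
move=> mA Afin mphi phiM phi0.
have -> : EFin \o phi = (EFin \o phi) \_ A.
  apply/funext => x; rewrite patchE; case: ifPn => // /negP.
  by rewrite inE => /phi0/= ->.
rewrite -integrable_mkcond//; apply: measurable_bounded_integrable => //.
  exact: measurable_funTS.
exists M; split; first exact: num_real.
by move=> N MN x _; apply: le_trans (phiM x) _; exact: ltW.
Qed.

(* The difference quotients of phi have integral 0 by translation invariance,
   and converge boundedly to the partial derivative. *)
Lemma integral_partial_eq0 i phi K : compact K -> (forall y, ~ K y -> phi y = 0) ->
  continuous phi -> (forall x, derivable phi x (delta_mx ord0 i)) ->
  continuous (partial i phi) ->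
  (\int[lebesgue R n]_x (partial i phi x)%:E = 0)%E.
Proof.
move=> cK phi0 cphi dphi cpart; pose e : 'rV[R]_n := delta_mx ord0 i.
have Kclosed : closed K by apply: compact_closed => //; exact: norm_hausdorff.
have [r0 [r0real rK]] := compact_bounded cK.
(* K lies in the ball of radius |r0| + 1; adding |e| makes room for its shifts by - h e with 0 <= h
   <= 1, so one ball [A] supports every difference quotient. *)
pose r := `|r0| + 1 + `|e|.
have [M0 M0ge phiM0] := continuous_compact_support_bounded cphi cK phi0.
have [M Mge phiM] := continuous_compact_support_bounded cpart cK
  (fun y => @partial_eq0 i phi K y Kclosed phi0).
pose A : set 'rV[R]_n := ball 0 (r + 1).
have mA : (lebesgue_om n).-cara.-measurable A.
  by apply: open_lebesgue_measurable; exact: ball_open.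
have Afin : (lebesgue R n A < +oo)%E.
  apply: lebesgue_bounded_lty; exists (r + 1); split; first exact: num_real.
  move=> N rN x; rewrite /A -ball_normE /= sub0r normrN => /ltW /le_trans; apply.
  exact: ltW.
have inA x : K x -> forall h, 0 <= h <= 1 -> A (x - h *: e).
  move=> Kx h /andP[h0 h1]; rewrite /A -ball_normE /= sub0r normrN.
  have := rK (`|r0| + 1) _ x Kx; rewrite (le_lt_trans (ler_norm r0)) ?ltrDl//.
  move=> /(_ isT) xr.
  rewrite (le_lt_trans (ler_normB _ _))// normrZ (ger0_norm h0).
  rewrite (@le_lt_trans _ _ (`|r0| + 1 + `|e|)) ?ltrDl//.
  by rewrite lerD// ler_piMl.
have KA x : K x -> A x.
  by move=> Kx; have := inA _ Kx 0; rewrite scale0r subr0; apply; rewrite lexx ler01.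
pose h k : R := k.+1%:R^-1.
have h01 k : 0 <= h k <= 1 by rewrite invr_ge0 ler0n invf_le1// ler1n.
have h_gt0 k : 0 < h k by rewrite invr_gt0.
pose f k (x : 'rV[R]_n) : R := (h k)^-1 * (phi (x + h k *: e) - phi x).
have outA k x : ~ A x -> f k x = 0.
  move=> Ax; have fx : phi x = 0 by apply: phi0 => /KA.
  have fxh : phi (x + h k *: e) = 0.
    by apply: phi0 => /inA/(_ (h k) (h01 k)); rewrite addrK.
  by rewrite /f fx fxh subrr mulr0.
have Kint : (lebesgue R n).-integrable setT (EFin \o phi).
  apply: (@integrable_bounded_support phi A M0 mA Afin) => //.
    exact: continuous_lebesgue_measurable.
  by move=> x Ax; apply: phi0 => /KA.
pose phih k (x : 'rV[R]_n) : R := phi (x + h k *: e).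
have ctr k : continuous (phih k).
  move=> x; apply: continuous_comp; last exact: cphi.
  by apply: (@continuousD _ _ _ id (cst (h k *: e))); [exact: cvg_id|exact: cst_continuous].
have Ktint k : (lebesgue R n).-integrable setT (EFin \o phih k).
  apply: (@integrable_bounded_support (phih k) A M0 mA Afin).
  - exact: continuous_lebesgue_measurable.
  - by move=> x; exact: phiM0.
  - move=> x Ax; apply: phi0 => Kx; apply: Ax.
    by have := inA _ Kx (h k) (h01 k); rewrite addrK.
have int0 k : (\int[lebesgue R n]_x (f k x)%:E = 0)%E.
  under eq_integral do rewrite EFinM EFinB.
  rewrite integralZl//; last exact: (integrableB measurableT (Ktint k) Kint).
  have trE := @integral_translate R n (h k *: e) phi Kint.
  rewrite (integralB_EFin measurableT (Ktint k) Kint) trE subee ?mule0//.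
  exact: integrable_fin_num.
have cf k : continuous (f k).
  move=> x; apply: (@continuousM _ _ (cst (h k)^-1) (phih k \- phi)).
    exact: cst_continuous.
  by apply: continuousB; [exact: ctr|exact: cphi].
(* The derivative is a limit along the punctured neighbourhoods of 0, so the steps must also be
   nonzero. *)
have h_cvg : h @ \oo --> 0^'.
  move=> B /= B0; have : \forall k \near \oo, h k != 0 -> B (h k).
    exact: (@cvg_harmonic R [set t | t != 0 -> B t] B0).
  by apply: filterS => k; apply; rewrite gt_eqF.
have f_cvg x : f ^~ x @ \oo --> partial i phi x.
  have -> : f ^~ x = (fun t => t^-1 *: ((phi \o shift x) (t *: e) - phi x)) \o h.
    by apply/funext => k; rewrite /f/= [x + _]addrC.
  apply: (cvg_comp _ _ h_cvg); exact: dphi.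
have [|||||_ _] := @dominated_convergence _ _ _ (lebesgue R n) setT measurableT
  (fun k x => (f k x)%:E) (fun x => (partial i phi x)%:E) ((cst M%:E) \_ A).
- move=> k; apply/measurable_EFinP; exact: continuous_lebesgue_measurable.
- apply/measurable_EFinP; exact: continuous_lebesgue_measurable.
- by apply: aeW => x _; apply: cvg_EFin; [exact: nearW|exact: f_cvg].
- rewrite -integrable_mkcond//; apply: measurable_bounded_integrable => //.
  exists M; split; first exact: num_real.
  by move=> N MN x _; rewrite /= ger0_norm// ltW.
- apply: aeW => x k _; rewrite patchE; case: ifPn => [_|/negP].
    rewrite lee_fin /f normrM ger0_norm ?invr_ge0 ?(ltW (h_gt0 k))//.
    rewrite ler_pdivrMl// mulrC; apply: increment_le => //.
    exact: ltW.
  by rewrite inE => /outA ->; rewrite abse0.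
move=> lim; apply: (cvg_unique _ lim) => //.
rewrite (_ : [sequence _]_n = cst 0%E); first exact: cvg_cst.
by apply/funext => k; exact: int0.
Qed.

Lemma test_function_partial Omega phi i : test_function Omega phi ->
  [/\ continuous phi, continuous (partial i phi),
      exists M, forall x, `|phi x| <= M /\ `|partial i phi x| <= M
    & (\int[lebesgue R n]_(x in Omega) (partial i phi x)%:E = 0)%E].
Proof.
move=> [sphi [K [cK KO phi0]]].
have [cphi /(_ i)[dphi cpart]] := sphi 1%N.
have Kclosed : closed K by apply: compact_closed => //; exact: norm_hausdorff.
have part0 y := @partial_eq0 i phi K y Kclosed phi0.
have [M0 M0ge phiM0] := continuous_compact_support_bounded cphi cK phi0.
have [M Mge phiM] := continuous_compact_support_bounded cpart cK part0.
split => //.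
  exists (M0 + M) => x; split; first by rewrite (le_trans (phiM0 x))// lerDl.
  by rewrite (le_trans (phiM x))// lerDr.
rewrite integral_mkcond -[RHS](integral_partial_eq0 cK phi0 cphi dphi cpart).
apply: eq_integral => x _; rewrite patchE; case: ifPn => // /negP.
by rewrite inE => Ox; rewrite part0// => /KO.
Qed.

End TestFunctions.

(** * Integral inequalities *)

Section LpFunctions.
Context {R : realType} d (T : measurableType d) (mu : {measure set T -> \bar R})
  (X : set T) (mX : measurable X).
Implicit Types (f g h : T -> R) (p a b : R).
Local Open Scope ereal_scope.

Lemma ae_imply2 (P Q S : T -> Prop) : (forall x, P x -> Q x -> S x) ->
  {ae mu, forall x, P x} -> {ae mu, forall x, Q x} -> {ae mu, forall x, S x}.
Proof. by move=> PQS; apply: filterS2 => x; exact: PQS. Qed.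

Lemma measurable_powR_EFin p f : measurable_fun X f ->
  measurable_fun X (fun x => (f x `^ p)%R%:E).
Proof.
move=> mf; apply/measurable_EFinP.
exact: (measurableT_comp (@measurable_powR R p) mf).
Qed.

Lemma measurable_lin (t : R) f g : measurable_fun X f -> measurable_fun X g ->
  measurable_fun X (fun x => f x + t * g x)%R.
Proof. by move=> mf mg; apply: measurable_funD => //; exact: measurable_funM. Qed.

Lemma measurable_linB (t : R) f g (f' g' : T -> R) :
  measurable_fun X f -> measurable_fun X g ->
  measurable_fun X f' -> measurable_fun X g' ->
  measurable_fun X (fun x => f x + t * g x - (f' x + t * g' x))%R.
Proof. by move=> *; apply: measurable_funB; exact: measurable_lin. Qed.

(** Nonnegativity takes the place of integrability, so that the bound can itself be used to
    establish that an integral is finite. *)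
Lemma ge0_integral_le_linear f g h a b : (0 <= a)%R -> (0 <= b)%R ->
  measurable_fun X f -> measurable_fun X g -> measurable_fun X h ->
  (forall x, X x -> 0 <= f x)%R -> (forall x, X x -> 0 <= g x)%R ->
  (forall x, X x -> 0 <= h x)%R ->
  (forall x, X x -> f x <= a * g x + b * h x)%R ->
  \int[mu]_(x in X) (f x)%:E <=
  a%:E * \int[mu]_(x in X) (g x)%:E + b%:E * \int[mu]_(x in X) (h x)%:E.
Proof.
move=> a0 b0 mf mg mh f0 g0 h0 fgh.
rewrite -!ge0_integralZl//; try by [apply/measurable_EFinP|rewrite lee_fin].
rewrite -ge0_integralD//=; first apply: ge0_le_integral => //=.
- exact/measurable_EFinP.
- by apply/measurable_EFinP; apply: measurable_funD; exact: measurable_funM.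
- by move=> x Xx; rewrite -EFinM lee_fin mulr_ge0// g0.
- by apply/measurable_EFinP; exact: measurable_funM.
- by move=> x Xx; rewrite -EFinM lee_fin mulr_ge0// h0.
- by apply/measurable_EFinP; exact: measurable_funM.
Qed.

Lemma integral_powR_split p A D k (eps : R) f g h : powR_split p A D k ->
  (0 < p)%R -> (0 < eps)%R ->
  measurable_fun X f -> measurable_fun X g -> measurable_fun X h ->
  (forall x, X x -> 0 <= f x)%R -> (forall x, X x -> 0 <= g x)%R ->
  (forall x, X x -> 0 <= h x)%R ->
  (forall x, X x -> f x <= g x + h x)%R ->
  \int[mu]_(x in X) (f x `^ p)%R%:E <=
  (1 + A * eps)%R%:E * \int[mu]_(x in X) (g x `^ p)%R%:E +
  (D + k * eps `^ (1 - p))%R%:E * \int[mu]_(x in X) (h x `^ p)%R%:E.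
Proof.
move=> [A0 D0 k0 split_p] p0 e0 mf mg mh f0 g0 h0 fgh.
have mp q : measurable_fun X q -> measurable_fun X (fun x => q x `^ p)%R.
  by move=> mq; apply/measurable_EFinP; exact: measurable_powR_EFin.
apply: ge0_integral_le_linear; try by [exact: mp|move=> *; exact: powR_ge0].
- by rewrite addr_ge0// mulr_ge0// ltW.
- by rewrite addr_ge0// mulr_ge0 ?powR_ge0// ltW.
move=> x Xx; apply: (@le_trans _ _ ((g x + h x) `^ p)%R).
  by rewrite ge0_ler_powR ?nnegrE ?(ltW p0) ?f0 ?addr_ge0 ?g0 ?h0 ?fgh.
by rewrite split_p ?g0 ?h0.
Qed.

Lemma integral_powRZ p t f : measurable_fun X f ->
  \int[mu]_(x in X) (`|t * f x| `^ p)%R%:E =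
  (`|t| `^ p)%R%:E * \int[mu]_(x in X) (`|f x| `^ p)%R%:E.
Proof.
move=> mf; have mfp : measurable_fun X (fun x => (`|f x| `^ p)%R%:E).
  by apply: measurable_powR_EFin; exact: measurableT_comp.
rewrite -ge0_integralZl//; try by move=> *; rewrite lee_fin powR_ge0.
by apply: eq_integral => x _; rewrite normrM powRM.
Qed.

(** Form for nonnegative functions under a triangle inequality; it is applied to Euclidean norms of
    vector fields, where f is not itself a linear combination of g and h. *)
Lemma integral_powR_lin p A D k (eps t : R) f g h : powR_split p A D k ->
  (0 < p)%R -> (0 < eps)%R ->
  measurable_fun X f -> measurable_fun X g -> measurable_fun X h ->
  (forall x, X x -> 0 <= f x)%R -> (forall x, X x -> 0 <= g x)%R ->
  (forall x, X x -> 0 <= h x)%R ->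
  (forall x, X x -> f x <= g x + `|t| * h x)%R ->
  \int[mu]_(x in X) (f x `^ p)%R%:E <=
  (1 + A * eps)%R%:E * \int[mu]_(x in X) (g x `^ p)%R%:E +
  ((D + k * eps `^ (1 - p)) * `|t| `^ p)%R%:E * \int[mu]_(x in X) (h x `^ p)%R%:E.
Proof.
move=> split_p p0 e0 mf mg mh f0 g0 h0 fgh.
have mth : measurable_fun X (fun x => `|t * h x|)%R.
  by apply: measurableT_comp => //; exact: measurable_funM.
have th0 x : X x -> (0 <= `|t * h x|)%R by [].
have fgth x : X x -> (f x <= g x + `|t * h x|)%R.
  by move=> Xx; rewrite normrM (ger0_norm (h0 _ Xx)) fgh.
have := integral_powR_split split_p p0 e0 mf mg mth f0 g0 th0 fgth.
rewrite (integral_powRZ p t mh) muleA -EFinM.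
have -> : \int[mu]_(x in X) (`|h x| `^ p)%R%:E = \int[mu]_(x in X) (h x `^ p)%R%:E.
  by apply: eq_integral => x /set_mem Xx; rewrite ger0_norm ?h0.
exact.
Qed.

Lemma integral_norm_powR_lin p A D k (eps t : R) f g h : powR_split p A D k ->
  (0 < p)%R -> (0 < eps)%R ->
  measurable_fun X f -> measurable_fun X g -> measurable_fun X h ->
  (forall x, X x -> f x = g x + t * h x)%R ->
  \int[mu]_(x in X) (`|f x| `^ p)%R%:E <=
  (1 + A * eps)%R%:E * \int[mu]_(x in X) (`|g x| `^ p)%R%:E +
  ((D + k * eps `^ (1 - p)) * `|t| `^ p)%R%:E * \int[mu]_(x in X) (`|h x| `^ p)%R%:E.
Proof.
move=> split_p p0 e0 mf mg mh fgh.
have mn (q : T -> R) : measurable_fun X q -> measurable_fun X (fun x => `|q x|)%R.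
  by move=> mq; exact: measurableT_comp.
apply: (integral_powR_lin split_p p0 e0 (mn _ mf) (mn _ mg) (mn _ mh)) => //.
by move=> x Xx; rewrite fgh// (le_trans (ler_normD _ _))// normrM.
Qed.

Lemma in_LpD p t f g : (1 < p)%R -> in_Lp mu X p f -> in_Lp mu X p g ->
  in_Lp mu X p (fun x => f x + t * g x)%R.
Proof.
move=> p1 [mf fp] [mg gp]; have mtg : measurable_fun X (fun x => t * g x)%R.
  exact: measurable_funM.
split; first exact: measurable_funD.
have [A [D [k split_p]]] := powR_split_exists p1.
have p0 : (0 < p)%R by exact: lt_trans p1.
have mf_tg : measurable_fun X (fun x => f x + t * g x)%R by exact: measurable_funD.
apply: (le_lt_trans (integral_norm_powR_lin split_p p0 ltr01 mf_tg mf mg _)) => //.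
case: split_p => A0 D0 k0 _.
apply: lte_add_pinfty.
  by apply: lte_mul_pinfty fp; rewrite // lee_fin addr_ge0 ?mulr_ge0.
apply: lte_mul_pinfty gp; rewrite // lee_fin mulr_ge0 ?powR_ge0//.
by rewrite addr_ge0 ?mulr_ge0 ?powR_ge0// ltW.
Qed.

Lemma in_Lp_cst p c : mu X < +oo -> in_Lp mu X p (cst c).
Proof.
move=> muX; split; first exact: measurable_cst.
change (\int[mu]_(x in X) cst (`|c| `^ p)%R%:E x < +oo).
by rewrite integral_cst// lte_mul_pinfty// lee_fin powR_ge0.
Qed.

(** Pointwise |f| <= 1 + |f|^p, and the constant 1 is integrable on a set of finite measure. *)
Lemma in_Lp_integrable p f : (1 < p)%R -> mu X < +oo -> in_Lp mu X p f ->
  mu.-integrable X (EFin \o f).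
Proof.
move=> p1 muX [mf fp]; apply/integrableP; split; first exact/measurable_EFinP.
have mfp : measurable_fun X (fun x => `|f x| `^ p)%R.
  by apply/measurable_EFinP; apply: measurable_powR_EFin; exact: measurableT_comp.
apply: (@le_lt_trans _ _ (1%:E * \int[mu]_(x in X) (cst 1%R x)%:E +
    1%:E * \int[mu]_(x in X) (`|f x| `^ p)%R%:E)).
  apply: ge0_integral_le_linear => //.
    exact: measurableT_comp.
  move=> x _; rewrite !mul1r; have [f1|f1] := leP `|f x|%R 1%R.
    by rewrite (le_trans f1)// lerDl powR_ge0.
  apply: (@le_trans _ _ (`|f x| `^ p)%R); last by rewrite lerDr.
  by apply: le1r_powR; exact: ltW.
rewrite !mul1e lte_add_pinfty//.
change (\int[mu]_(x in X) cst (1%:E : \bar R) x < +oo).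
by rewrite integral_cst// mul1e.
Qed.

(** Through [enorm_le_sum] this makes the gradient integral finite, membership in L^p being assumed
    for each coordinate separately. *)
Lemma in_Lp_sum p I (s : seq I) (f : I -> T -> R) : (1 < p)%R -> mu X < +oo ->
  (forall i, in_Lp mu X p (f i)) ->
  in_Lp mu X p (fun x => \sum_(i <- s) `|f i x|)%R.
Proof.
move=> p1 muX fp; elim: s => [|i s ih].
  by under eq_fun do rewrite big_nil; exact: in_Lp_cst.
under eq_fun do rewrite big_cons addrC -[`|f i _|%R]mul1r.
apply: (in_LpD _ p1 ih).
have [mf fip] := fp i; split; first exact: measurableT_comp.
by under eq_integral do rewrite normr_id.
Qed.

Lemma ge0_integral_powR_le p f g : (0 <= p)%R ->
  measurable_fun X f -> measurable_fun X g ->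
  (forall x, X x -> 0 <= f x)%R -> (forall x, X x -> f x <= g x)%R ->
  \int[mu]_(x in X) (f x `^ p)%R%:E <= \int[mu]_(x in X) (g x `^ p)%R%:E.
Proof.
move=> p0 mf mg f0 fg; apply: ge0_le_integral => //.
- by move=> x _; rewrite lee_fin powR_ge0.
- exact: measurable_powR_EFin.
- exact: measurable_powR_EFin.
move=> x Xx; have := f0 _ Xx; have := fg _ Xx => fgx fx0.
by rewrite lee_fin ge0_ler_powR ?nnegrE// (le_trans fx0).
Qed.

(** Jensen's inequality for the mean c: integrate the tangent inequality at |c|, evaluated at |f|,
    and use |c| V <= \int |f|. *)
Lemma powR_mean_le p f (c V : R) : (1 < p)%R -> in_Lp mu X p f ->
  mu X = V%:E -> \int[mu]_(x in X) (f x)%:E = (c * V)%:E ->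
  (`|c| `^ p * V)%:E <= \int[mu]_(x in X) (`|f x| `^ p)%R%:E.
Proof.
move=> p1 fLp muX intf; have [mf fp] := fLp.
have p0 : (0 < p)%R by exact: lt_trans p1.
have U0 : 0 <= \int[mu]_(x in X) (`|f x| `^ p)%R%:E.
  by apply: integral_ge0 => x _; rewrite lee_fin powR_ge0.
have mn : measurable_fun X (fun x => `|f x|)%R by exact: measurableT_comp.
have mnp : measurable_fun X (fun x => `|f x| `^ p)%R.
  by apply/measurable_EFinP; exact: measurable_powR_EFin.
have V0 : (0 <= V)%R by rewrite -lee_fin -muX.
pose q := (p * `|c| `^ (p - 1))%R.
have q0 : (0 <= q)%R by rewrite mulr_ge0 ?powR_ge0// ltW.
have mqn : measurable_fun X (fun x => q * `|f x|)%R by exact: measurable_funM.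
have pt x : X x -> (q * `|f x| <= ((p - 1) * `|c| `^ p) * cst 1 x + 1 * `|f x| `^ p)%R.
  by move=> _; rewrite mulr1 mul1r; apply: powR_tangent => //; exact: ltW.
have p10 : (0 <= (p - 1) * `|c| `^ p)%R.
  by rewrite mulr_ge0 ?powR_ge0// subr_ge0 ltW.
have mc : measurable_fun X (cst 1%R : T -> R) by exact: measurable_cst.
have qn0 x : X x -> (0 <= q * `|f x|)%R by move=> _; rewrite mulr_ge0.
have n0 x : X x -> (0 <= `|f x| `^ p)%R by move=> _; rewrite powR_ge0.
have c0 x : X x -> (0 <= (cst 1 : T -> R) x)%R by [].
have := ge0_integral_le_linear p10 ler01 mqn mc mnp qn0 c0 n0 pt.
have -> : \int[mu]_(x in X) ((cst 1 : T -> R) x)%:E = V%:E.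
  change (\int[mu]_(x in X) cst (1%:E : \bar R) x = V%:E).
  by rewrite integral_cst// mul1e muX.
have := le_abse_integral mu mX ((measurable_EFinP X f).2 mf).
rewrite intf => cV; have qcV : (q * (`|c| * V))%:E <= \int[mu]_(x in X) (q * `|f x|)%:E.
  under eq_integral do rewrite EFinM.
  rewrite ge0_integralZl//; last exact/measurable_EFinP.
  rewrite EFinM lee_wpmul2l ?lee_fin//; apply: le_trans cV.
  by rewrite /= normrM (ger0_norm V0).
move=> /(le_trans qcV); move: fp U0.
case: (\int[mu]_(x in X) (`|f x| `^ p)%:E) => [U| |]// _ _.
rewrite -!EFinM -EFinD !lee_fin.
have -> : (q * (`|c| * V) = p * (`|c| `^ p * V))%R.
  by rewrite /q -(mulr_powRB1 (normr_ge0 c) p0); ring.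
move=> h; lra.
Qed.

End LpFunctions.

(** * The Euclidean norm *)

Section EuclideanNorm.
Context {R : realType} {n : nat}.
Implicit Types (x y : 'rV[R]_n) (t : R).

Lemma enorm_ge0 x : 0 <= enorm x. Proof. exact: sqrtr_ge0. Qed.

(** Cauchy-Schwarz by Lagrange's identity: the double sum of (x_i y_j - x_j y_i)^2 equals 2 (|x|^2
    |y|^2 - (x.y)^2). *)
Lemma edot_le x y : edot x y <= enorm x * enorm y.
Proof.
rewrite /enorm -sqrtrM ?sumr_ge0// => [|i _]; last exact: sqr_ge0.
rewrite (le_trans (ler_norm _))// -sqrtr_sqr ler_sqrt; last first.
  by rewrite mulr_ge0// sumr_ge0// => i _; exact: sqr_ge0.
have : 0 <= \sum_(i < n) \sum_(j < n) (x ord0 i * y ord0 j - x ord0 j * y ord0 i) ^+ 2.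
  by rewrite sumr_ge0// => i _; rewrite sumr_ge0// => j _; exact: sqr_ge0.
set X := \sum_(i < n) x ord0 i ^+ 2; set Y := \sum_(i < n) y ord0 i ^+ 2.
have -> : \sum_(i < n) \sum_(j < n) (x ord0 i * y ord0 j - x ord0 j * y ord0 i) ^+ 2
    = 2 * (X * Y - edot x y ^+ 2).
  have XY : \sum_(i < n) \sum_(j < n) x ord0 i ^+ 2 * y ord0 j ^+ 2 = X * Y.
    by rewrite /X /Y big_distrlr.
  have D2 : \sum_(i < n) \sum_(j < n) (x ord0 i * y ord0 i) * (x ord0 j * y ord0 j)
      = edot x y ^+ 2.
    by rewrite expr2 /edot big_distrlr.
  transitivity (\sum_(i < n) \sum_(j < n) x ord0 i ^+ 2 * y ord0 j ^+ 2 +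
     \sum_(i < n) \sum_(j < n) x ord0 j ^+ 2 * y ord0 i ^+ 2 -
     2 * \sum_(i < n) \sum_(j < n) (x ord0 i * y ord0 i) * (x ord0 j * y ord0 j)).
    rewrite mulr_sumr -big_split/= -sumrB; apply: eq_bigr => i _.
    rewrite mulr_sumr -big_split/= -sumrB; apply: eq_bigr => j _; ring.
  rewrite [X in _ + X - _]exchange_big/= XY D2; ring.
by rewrite pmulr_rge0// subr_ge0.
Qed.

Lemma enorm_sqr x : enorm x ^+ 2 = edot x x.
Proof. by rewrite sqr_sqrtr// sumr_ge0// => i _; exact: sqr_ge0. Qed.

Lemma enormD x y : enorm (x + y) <= enorm x + enorm y.
Proof.
rewrite -ler_sqr ?nnegrE ?addr_ge0 ?enorm_ge0// sqrrD !enorm_sqr.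
have -> : edot (x + y) (x + y) = edot x x + edot x y *+ 2 + edot y y.
  rewrite /edot mulr2n -!big_split/=; apply: eq_bigr => i _; rewrite !mxE; ring.
by rewrite lerD2r lerD2l lerMn2r edot_le.
Qed.

Lemma enormZ t x : enorm (t *: x) = `|t| * enorm x.
Proof.
rewrite /enorm -sqrtr_sqr -sqrtrM ?sqr_ge0// mulr_sumr; congr Num.sqrt.
by apply: eq_bigr => i _; rewrite mxE exprMn.
Qed.

Lemma enorm_le_sum x : enorm x <= \sum_(i < n) `|x ord0 i|.
Proof.
have s0 : 0 <= \sum_(i < n) `|x ord0 i| by rewrite sumr_ge0.
rewrite -ler_sqr ?nnegrE ?enorm_ge0// enorm_sqr /edot expr2 mulr_suml.
apply: ler_sum => i _; rewrite -expr2 -real_normK ?num_real// expr2 ler_wpM2l//.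
by rewrite (bigD1 i)//= lerDl sumr_ge0.
Qed.

Lemma measurable_enorm d (T : measurableType d) (X : set T) (V : T -> 'rV[R]_n) :
  (forall i, measurable_fun X (fun z => V z ord0 i)) ->
  measurable_fun X (fun z => enorm (V z)).
Proof.
move=> mV; apply: (@measurableT_comp _ _ _ _ _ _ (@Num.sqrt R) X
  (fun z => \sum_(i < n) V z ord0 i ^+ 2)).
  by apply: continuous_measurable_fun; exact: sqrt_continuous.
by apply: measurable_sum => i; exact: measurable_funX.
Qed.

End EuclideanNorm.

(** * Sobolev functions and traces *)

Section SmoothFunctions.
Context {R : realType} {n : nat}.
Implicit Types (phi psi : 'rV[R]_n -> R).

Lemma partial_lin i (t : R) phi psi :
  (forall x, derivable phi x (delta_mx ord0 i)) ->
  (forall x, derivable psi x (delta_mx ord0 i)) ->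
  partial i (fun x => phi x + t * psi x) = (fun x => partial i phi x + t * partial i psi x).
Proof.
move=> dphi dpsi; apply/funext => x.
rewrite /partial (_ : (fun _ => _) = phi + t *: psi); last exact/funext.
by rewrite deriveD//; [rewrite deriveZ|exact: derivableZ].
Qed.

Lemma class_C_lin k (t : R) phi psi : class_C k phi -> class_C k psi ->
  class_C k (fun x => phi x + t * psi x).
Proof.
have lin f g : continuous f -> continuous g ->
    continuous (fun x : 'rV[R]_n => f x + t * g x : R).
  move=> cf cg x; apply: (@continuousD _ _ _ f (fun y => t * g y)); first exact: cf.
  by apply: (@continuousM _ _ (cst t) g); [exact: cst_continuous|exact: cg].
elim: k phi psi => [|k ih] phi psi; first exact: lin.
move=> [cphi Dphi] [cpsi Dpsi]; split; first exact: lin.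
move=> i; have [dphi Cphi] := Dphi i; have [dpsi Cpsi] := Dpsi i.
split=> [x|]; last by rewrite partial_lin//; exact: ih.
rewrite (_ : (fun _ => _) = phi + t *: psi); last exact/funext.
by apply: derivableD => //; exact: derivableZ.
Qed.

Lemma smooth_derivable phi : smooth phi ->
  forall i x, derivable phi x (delta_mx ord0 i).
Proof. by move=> /(_ 1%N)[_ D] i x; have [] := D i. Qed.

Lemma smooth_continuous phi : smooth phi -> continuous phi.
Proof. by move=> /(_ 0%N). Qed.

Lemma smooth_partial_continuous phi i : smooth phi -> continuous (partial i phi).
Proof. by move=> /(_ 1%N)[_ /(_ i)[]]. Qed.

Lemma smooth_lin (t : R) phi psi : smooth phi -> smooth psi ->
  smooth (fun x => phi x + t * psi x).
Proof. by move=> sphi spsi k; exact: class_C_lin. Qed.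

Lemma grad_lin (t : R) phi psi x : smooth phi -> smooth psi ->
  grad (fun y => phi y + t * psi y) x = grad phi x + t *: grad psi x.
Proof.
move=> sphi spsi; apply/rowP => i; rewrite !mxE partial_lin//;
  by move=> y; exact: smooth_derivable.
Qed.

Lemma partial_cst i (c : R) : partial i (cst c : 'rV[R]_n -> R) = cst 0.
Proof. by apply/funext => x; rewrite /partial derive_cst. Qed.

Lemma smooth_cst (c : R) : smooth (cst c : 'rV[R]_n -> R).
Proof.
move=> k; elim: k c => [|k ih] c; first exact: cst_continuous.
split=> [|i]; first exact: cst_continuous.
by split=> [x|]; [exact: derivable_cst|rewrite partial_cst].
Qed.

Lemma grad_cst (c : R) x : grad (cst c : 'rV[R]_n -> R) x = 0.
Proof. by apply/rowP => i; rewrite !mxE partial_cst. Qed.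

End SmoothFunctions.

Lemma cvge0_le_lin {R : realType} (f g h : nat -> \bar R) (a b : R) :
  (forall k, 0 <= f k)%E -> (forall k, f k <= a%:E * g k + b%:E * h k)%E ->
  g @ \oo --> 0%E -> h @ \oo --> 0%E -> f @ \oo --> 0%E.
Proof.
move=> f0 fgh g0 h0; apply: (@squeeze_cvge _ _ _ _ (cst 0%E) _
  (fun k => a%:E * g k + b%:E * h k)%E); first by apply: nearW => k; rewrite f0 fgh.
  exact: cvg_cst.
have -> : 0%E = (a%:E * 0 + b%:E * 0)%E :> \bar R by rewrite !mule0 adde0.
by apply: cvgeD; [rewrite !mule0|exact: cvgeZl|exact: cvgeZl].
Qed.

Section SobolevSpace.
Context {R : realType} {n : nat} (Omega : set 'rV[R]_n) (p : R).
Hypotheses (openO : open Omega) (boundedO : bounded_set Omega) (p1 : 1 < p).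
Implicit Types (u v g h w : 'rV[R]_n -> R) (G H : 'rV[R]_n -> 'rV[R]_n).

Let p0 : 0 < p. Proof. exact: lt_trans p1. Qed.

Let mO : (lebesgue_om n).-cara.-measurable Omega.
Proof. exact: open_lebesgue_measurable. Qed.

Let Ofin : (lebesgue R n Omega < +oo)%E.
Proof. exact: lebesgue_bounded_lty. Qed.

Let mB : (hausdorff_om n n.-1).-cara.-measurable (boundary Omega).
Proof. exact: boundary_surface_measurable. Qed.

Lemma in_Lp_test_integrable f b M : in_Lp (lebesgue R n) Omega p f ->
  continuous b -> (forall x, `|b x| <= M) ->
  (lebesgue R n).-integrable Omega (EFin \o (fun x : 'rV[R]_n => f x * b x)).
Proof.
move=> fp cb bM.
rewrite (_ : EFin \o _ = ((EFin \o b) \* (EFin \o f))%E); last first.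
  by apply/funext => x; rewrite /= mulrC EFinM.
apply: integrableMr => //; last exact: in_Lp_integrable p1 Ofin fp.
  exact: continuous_lebesgue_measurable.
exists M; split; first exact: num_real.
by move=> N MN x _; apply: le_trans (bM x) _; exact: ltW.
Qed.

Lemma integral_test_lin (f g b : 'rV[R]_n -> R) M t :
  in_Lp (lebesgue R n) Omega p f -> in_Lp (lebesgue R n) Omega p g ->
  continuous b -> (forall x, `|b x| <= M) ->
  (\int[lebesgue R n]_(x in Omega) ((f x + t * g x) * b x)%:E =
   \int[lebesgue R n]_(x in Omega) (f x * b x)%:E +
   t%:E * \int[lebesgue R n]_(x in Omega) (g x * b x)%:E)%E.
Proof.
move=> fp gp cb bM.
have fb := in_Lp_test_integrable fp cb bM; have gb := in_Lp_test_integrable gp cb bM.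
rewrite -integralZl// -integralD//; last exact: integrableZl.
by apply: eq_integral => x _; rewrite /= -EFinM -EFinD; congr EFin; ring.
Qed.

Lemma weak_gradient_lin t u G v H : sobolev p Omega u G -> sobolev p Omega v H ->
  weak_gradient Omega (fun x => u x + t * v x) (fun x => G x + t *: H x).
Proof.
move=> [up Gp uG] [vp Hp vH] phi i tphi.
have [cphi cpart [M phiM] _] := test_function_partial i tphi.
rewrite (integral_test_lin t up vp cpart (fun x => (phiM x).2)) (uG _ _ tphi) (vH _ _ tphi).
have GHE : (\int[lebesgue R n]_(x in Omega) ((G x + t *: H x)%R ord0 i * phi x)%:E =
    \int[lebesgue R n]_(x in Omega) ((G x ord0 i + t * H x ord0 i) * phi x)%:E)%E.
  by apply: eq_integral => x _; rewrite !mxE.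
rewrite GHE (integral_test_lin t (Gp i) (Hp i) cphi (fun x => (phiM x).1)).
have Gi := in_Lp_test_integrable (Gp i) cphi (fun x => (phiM x).1).
have Hi := in_Lp_test_integrable (Hp i) cphi (fun x => (phiM x).1).
(* Negation distributes over a sum of extended reals only away from opposite infinities, so both
   integrals are first shown finite. *)
have Gf := integrable_fin_num mO Gi; have Hf := integrable_fin_num mO Hi.
by rewrite oppeD ?fin_num_adde_defl ?fin_numM// muleN.
Qed.

Lemma sobolev_lin t u G v H : sobolev p Omega u G -> sobolev p Omega v H ->
  sobolev p Omega (fun x => u x + t * v x) (fun x => G x + t *: H x).
Proof.
move=> uG vH; split; last exact: weak_gradient_lin.
  by case: uG vH => up _ _ [vp _ _]; exact: in_LpD.
move=> i; under eq_fun do rewrite !mxE.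
by case: uG vH => _ Gp _ [_ Hp _]; exact: (in_LpD mO _ p1 (Gp i) (Hp i)).
Qed.

(** The combinations phi_j + t psi_j approximate. Each of the three errors is bounded by a fixed
    multiple of the two given errors, through the splitting inequality with eps = 1 in the role of
    Minkowski's inequality. *)
Lemma trace_lin t u G g v H h :
  sobolev p Omega u G -> sobolev p Omega v H ->
  trace p Omega u G g -> trace p Omega v H h ->
  trace p Omega (fun x => u x + t * v x) (fun x => G x + t *: H x)
    (fun x => g x + t * h x).
Proof.
move=> [[mu _] Gp _] [[mv _] Hp _].
move=> [gp [phi [sphi phiu phiG phig]]] [hp [psi [spsi psiv psiH psih]]].
split; first exact: in_LpD.
have [A [D [k split_p]]] := powR_split_exists p1.
have mG i : measurable_fun (Omega : set (caratheodory_type (lebesgue_om n)))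
    (fun x => G x ord0 i) by case: (Gp i).
have mH i : measurable_fun (Omega : set (caratheodory_type (lebesgue_om n)))
    (fun x => H x ord0 i) by case: (Hp i).
pose c := (D + k * 1 `^ (1 - p)) * `|t| `^ p.
have E (a b q r : R) : a + t * b - (q + t * r) = a - q + t * (b - r) by ring.
exists (fun j x => phi j x + t * psi j x); split.
- by move=> j; exact: smooth_lin.
- apply: (@cvge0_le_lin _ _ _ _ (1 + A * 1) c _ _ phiu psiv) => j.
    by apply: integral_ge0 => x _; rewrite lee_fin powR_ge0.
  have mphi := @continuous_lebesgue_measurable R n _ Omega (smooth_continuous (sphi j)).
  have mpsi := @continuous_lebesgue_measurable R n _ Omega (smooth_continuous (spsi j)).
  apply: (@integral_norm_powR_lin _ _ _ _ _ mO _ _ _ _ _ t _ _ _ split_p p0 ltr01).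
  + exact: (measurable_linB t mphi mpsi mu mv).
  + exact: (measurable_funB mphi mu).
  + exact: (measurable_funB mpsi mv).
  + by move=> x _; rewrite E.
- apply: (@cvge0_le_lin _ _ _ _ (1 + A * 1) c _ _ phiG psiH) => j.
    by apply: integral_ge0 => x _; rewrite lee_fin powR_ge0.
  have mpart q i : smooth q ->
      measurable_fun (Omega : set (caratheodory_type (lebesgue_om n))) (partial i q).
    by move=> sq; apply: continuous_lebesgue_measurable; exact: smooth_partial_continuous.
  have mphi i := mpart _ i (sphi j); have mpsi i := mpart _ i (spsi j).
  apply: (@integral_powR_lin _ _ _ _ _ mO _ _ _ _ _ t _ _ _ split_p p0 ltr01).
  + apply: measurable_enorm => i; under eq_fun do rewrite grad_lin// !mxE.
    exact: (measurable_linB t (mphi i) (mpsi i) (mG i) (mH i)).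
  + apply: measurable_enorm => i; under eq_fun do rewrite !mxE.
    exact: (measurable_funB (mphi i) (mG i)).
  + apply: measurable_enorm => i; under eq_fun do rewrite !mxE.
    exact: (measurable_funB (mpsi i) (mH i)).
  + by move=> x _; exact: enorm_ge0.
  + by move=> x _; exact: enorm_ge0.
  + by move=> x _; exact: enorm_ge0.
  + move=> x _; rewrite grad_lin// -enormZ; apply: le_trans (enormD _ _).
    by rewrite scalerBr opprD addrACA.
- apply: (@cvge0_le_lin _ _ _ _ (1 + A * 1) c _ _ phig psih) => j.
    by apply: integral_ge0 => x _; rewrite lee_fin powR_ge0.
  have mphi := @continuous_surface_measurable R n _ (boundary Omega) (smooth_continuous (sphi j)).
  have mpsi := @continuous_surface_measurable R n _ (boundary Omega) (smooth_continuous (spsi j)).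
  case: gp hp => mg _ [mh _].
  apply: (@integral_norm_powR_lin _ _ _ _ _ mB _ _ _ _ _ t _ _ _ split_p p0 ltr01).
  + exact: (measurable_linB t mphi mpsi mg mh).
  + exact: (measurable_funB mphi mg).
  + exact: (measurable_funB mpsi mh).
  + by move=> x _; rewrite E.
Qed.

Lemma sobolev_trace_lin t u G g v H h :
  sobolev_trace p Omega u G g -> sobolev_trace p Omega v H h ->
  sobolev_trace p Omega (fun x => u x + t * v x) (fun x => G x + t *: H x)
    (fun x => g x + t * h x).
Proof.
by move=> [uG tu] [vH tv]; split; [exact: sobolev_lin|exact: trace_lin].
Qed.

Lemma sobolev_trace_cst c : (surface R n (boundary Omega) < +oo)%E ->
  sobolev_trace p Omega (cst c) (cst 0) (cst c).
Proof.
move=> Sfin; split; first split.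
- exact: in_Lp_cst.
- move=> i; under eq_fun do rewrite mxE.
  exact: in_Lp_cst.
- move=> phi i tphi; have [_ _ _ int0] := test_function_partial i tphi.
  have [_ cpart [M phiM] _] := test_function_partial i tphi.
  under [in RHS]eq_integral do rewrite mxE mul0r.
  rewrite integral0 oppe0.
  under eq_integral do rewrite EFinM.
  rewrite integralZl ?int0 ?mule0//.
  rewrite (_ : (fun _ => _) = EFin \o (fun x => cst 1 x * partial i phi x)); last first.
    by apply/funext => x; rewrite /= mul1r.
  apply: (@in_Lp_test_integrable _ _ M) => //; first exact: in_Lp_cst.
  by move=> x; have [] := phiM x.
split; first exact: in_Lp_cst.
exists (fun=> cst c); split.
- by move=> _; exact: smooth_cst.
- under eq_fun do under eq_integral do rewrite subrr normr0 powR0 ?gt_eqF//.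
  by under eq_fun do rewrite integral0; exact: cvg_cst.
- have e0 : enorm (0 : 'rV[R]_n) = 0.
    by rewrite /enorm big1 ?sqrtr0// => i _; rewrite mxE expr0n.
  under eq_fun do under eq_integral do rewrite grad_cst subrr e0 powR0 ?gt_eqF//.
  by under eq_fun do rewrite integral0; exact: cvg_cst.
- under eq_fun do under eq_integral do rewrite subrr normr0 powR0 ?gt_eqF//.
  by under eq_fun do rewrite integral0; exact: cvg_cst.
Qed.

Lemma measurable_sobolev_enorm u G : sobolev p Omega u G ->
  measurable_fun (Omega : set (caratheodory_type (lebesgue_om n))) (fun x => enorm (G x)).
Proof. by move=> [_ Gp _]; apply: measurable_enorm => i; case: (Gp i). Qed.

Lemma gradient_integral_lty u G : sobolev p Omega u G ->
  (gradient_integral p Omega G < +oo)%E.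
Proof.
move=> uG; have mG := measurable_sobolev_enorm uG; case: uG => _ Gp _.
have [ms sfin] := in_Lp_sum mO (index_enum 'I_n) p1 Ofin Gp.
apply: le_lt_trans sfin.
have mn : measurable_fun (Omega : set (caratheodory_type (lebesgue_om n)))
    (fun x => `|\sum_(i < n) `|G x ord0 i| |) by exact: measurableT_comp.
apply: (ge0_integral_powR_le _ mO (ltW p0) mG mn) => [x _|x _].
  exact: enorm_ge0.
by rewrite ger0_norm ?sumr_ge0//; exact: enorm_le_sum.
Qed.

End SobolevSpace.

(** * The first Robin eigenvalue *)

Section RobinEigenvalue.
Context {R : realType}.

Lemma ge0_lty_real (x : \bar R) : (0 <= x)%E -> (x < +oo)%E ->
  exists2 r : R, 0 <= r & x = r%:E.
Proof. by case: x => [r| |]//; rewrite lee_fin => r0 _; exists r. Qed.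

Lemma le_limit_linear (x a b : R) : 0 <= b ->
  (forall e, 0 < e -> x <= a + b * e) -> x <= a.
Proof.
move=> b0 H; rewrite leNgt; apply/negP => ax.
have b1 : 0 < b + 1 by rewrite ltr_wpDl.
have e0 : 0 < (x - a) / (b + 1) by rewrite divr_gt0// subr_gt0.
have := H _ e0; rewrite -lerBlDl leNgt => /negP; apply.
by rewrite mulrA ltr_pdivrMr// mulrC ltr_pM2l ?subr_gt0// ltrDl.
Qed.

(** Real-number core of the perturbation w + s v: x and y are the boundary and gradient integrals of
    w, those of v are [w] and z, and b and gr belong to w + s v. For fixed e let s tend to 0, then
    let e tend to 0. *)
Lemma powR_split_limit p A D k (x r y z w : R) : powR_split p A D k -> 0 < p ->
  0 <= r -> 0 <= y -> 0 <= z -> 0 <= w ->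
  (forall e s, 0 < e -> 0 < s ->
    exists b gr, [/\ x <= (1 + A * e) * b + (D + k * e `^ (1 - p)) * s `^ p * w,
      gr <= (1 + A * e) * y + (D + k * e `^ (1 - p)) * s `^ p * z & b <= r * gr]) ->
  x <= r * y.
Proof.
move=> [A0 D0 k0 _] p0 r0 y0 z0 w0 H.
have step e : 0 < e -> x <= (1 + A * e) ^+ 2 * (r * y).
  move=> e0; pose K := D + k * e `^ (1 - p).
  have K0 : 0 <= K by rewrite addr_ge0 ?mulr_ge0 ?powR_ge0// ltW.
  have e1 : 0 <= 1 + A * e by rewrite addr_ge0// mulr_ge0// ltW.
  apply: (@le_limit_linear _ _ ((1 + A * e) * r * K * z + K * w)).
    by rewrite addr_ge0 ?mulr_ge0.
  move=> d d0; have s0 : 0 < d `^ p^-1 by exact: powR_gt0.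
  have [b [gr]] := H e _ e0 s0.
  rewrite -powRrM mulVf ?gt_eqF// powRr1 ?(ltW d0)// -/K => -[xb gry bgr].
  have h1 : r * gr <= r * ((1 + A * e) * y + K * d * z) by rewrite ler_wpM2l.
  have h2 : (1 + A * e) * b <= (1 + A * e) * (r * ((1 + A * e) * y + K * d * z)).
    by rewrite ler_wpM2l// (le_trans bgr).
  apply: (le_trans xb); apply: (le_trans (lerD h2 (lexx _))).
  by rewrite le_eqVlt; apply/orP; left; apply/eqP; ring.
have ry : 0 <= r * y by exact: mulr_ge0.
apply: (@le_limit_linear _ _ ((2 * A + A ^+ 2) * (r * y))).
  by rewrite mulr_ge0// addr_ge0 ?mulr_ge0// sqr_ge0.
(* Capping at 1 gives m^2 <= m, which makes the quadratic term of (1 + A m)^2 linear in e. *)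
move=> e e0; pose m := Num.min e 1.
have m0 : 0 < m by rewrite lt_min e0 ltr01.
have m1 : m <= 1 by rewrite ge_min lexx orbT.
have me : m <= e by rewrite ge_min lexx.
apply: (le_trans (step m m0)).
have -> : (1 + A * m) ^+ 2 * (r * y) = r * y + (2 * A + A ^+ 2 * m) * (r * y) * m by ring.
rewrite lerD2l ler_pM ?(ltW m0) ?mulr_ge0 ?addr_ge0 ?mulr_ge0 ?sqr_ge0 ?(ltW m0)//.
by rewrite ler_wpM2r// lerD2l ler_piMr// sqr_ge0.
Qed.

(* For r > 0 the parameter eps is chosen so that the w-term is absorbed by the
   gradient; for r = 0 every eps > 0 is allowed. *)
Lemma quotient_lower_bound p A D k (a r S V U c gr b b' : R) :
  powR_split p A D k -> 1 < p -> 0 < a -> 0 <= r -> D * a * r < 1 ->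
  0 <= S -> 0 < V -> 0 < U -> 0 <= c -> 0 <= gr ->
  c * V <= U -> b' <= r * gr ->
  (forall e, 0 < e -> b <= (1 + A * e) * (c * S) + (D + k * e `^ (1 - p)) * b') ->
  - a * (S / V) * (1 + A * (k * a * r / (1 - D * a * r)) `^ (p - 1)^-1) <=
  (gr - a * b) / U.
Proof.
move=> [A0 D0 k0 _] p1 a0 r0 Dar S0 V0 U0 c0 gr0 cVU b'r Hb.
rewrite ler_pdivlMr//.
(* The condition on e says that a times the w-term is at most gr, so only the term in c survives;
   there c <= U / V is inserted. *)
have main e : 0 < e -> a * r * (D + k * e `^ (1 - p)) <= 1 ->
    - a * (S / V) * (1 + A * e) * U <= gr - a * b.
  move=> e0 aK; set K := D + k * e `^ (1 - p) in aK.
  have K0 : 0 <= K by rewrite addr_ge0 ?mulr_ge0 ?powR_ge0// ltW.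
  have h1 : a * b <= a * ((1 + A * e) * (c * S) + K * b') by rewrite ler_wpM2l ?(ltW a0)// Hb.
  have h2 : a * K * b' <= a * K * (r * gr) by rewrite ler_wpM2l// mulr_ge0// ltW.
  have h3 : a * r * K * gr <= 1 * gr by rewrite ler_wpM2r.
  have cUV : c <= U / V by rewrite ler_pdivlMr.
  have h4 : a * (1 + A * e) * S * c <= a * (1 + A * e) * S * (U / V).
    rewrite ler_wpM2l// !mulr_ge0 ?addr_ge0 ?mulr_ge0//; exact: ltW.
  have E : - a * (S / V) * (1 + A * e) * U = - (a * (1 + A * e) * S * (U / V)) by ring.
  rewrite E; move: h1 h2 h3 h4.
  have -> : a * ((1 + A * e) * (c * S) + K * b') = a * (1 + A * e) * S * c + a * K * b' by ring.
  have -> : a * r * K * gr = a * K * (r * gr) by ring.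
  lra.
have p10 : p - 1 != 0 by rewrite subr_eq0 gt_eqF.
(* For r = 0 the power in the statement is 0^(1/(p-1)) = 0, which is the limit e -> 0 of [main]. *)
have [r_eq0|r_neq0] := eqVneq r 0.
  have lim e : 0 < e -> - (gr - a * b) <= a * (S / V) * U + a * (S / V) * U * A * e.
    move=> e0; have := main _ e0; rewrite r_eq0 mulr0 mul0r => /(_ ler01).
    rewrite !mulNr -lerN2 opprK => h; apply: le_trans h _.
    by rewrite le_eqVlt; apply/orP; left; apply/eqP; ring.
  rewrite r_eq0 !mulr0 mul0r powR0 ?invr_eq0// mulr0 addr0 mulr1 !mulNr -lerN2 opprK.
  apply: le_limit_linear lim; rewrite !mulr_ge0// ?invr_ge0; exact: ltW.
have r_gt0 : 0 < r by rewrite lt_def r_neq0.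
(* Solving a r (D + k e^(1-p)) = 1 for e gives e^(p-1) = t, so [main] is applied with its hypothesis
   an equality. *)
set t := k * a * r / (1 - D * a * r).
have t0 : 0 < t by rewrite divr_gt0 ?mulr_gt0// subr_gt0.
apply: main; first exact: powR_gt0.
rewrite -powRrM.
have -> : (p - 1)^-1 * (1 - p) = -1 by field.
rewrite powR_inv1 ?(ltW t0)// /t invf_div.
rewrite le_eqVlt; apply/orP; left; apply/eqP; field.
by rewrite r_neq0 !gt_eqF.
Qed.

Context {n : nat} (Omega : set 'rV[R]_n).
Hypotheses (openO : open Omega) (boundedO : bounded_set Omega).
Implicit Types (p alpha : R).

Let mO : (lebesgue_om n).-cara.-measurable Omega.
Proof. exact: open_lebesgue_measurable. Qed.

Let Ofin : (lebesgue R n Omega < +oo)%E.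
Proof. exact: lebesgue_bounded_lty. Qed.

Let mB : (hausdorff_om n n.-1).-cara.-measurable (boundary Omega).
Proof. exact: boundary_surface_measurable. Qed.

(* An infinite constant (either sign, the supremum of the empty set included)
   contradicts the hypothesis on alpha, since x / +oo = 0 and 1 / -oo = -oo. *)
Lemma trace_constant_real p alpha (c q : R) : 0 < c -> 0 < q -> alpha < 0 ->
  (- c%:E / (q%:E * trace_constant p Omega) < alpha%:E)%E ->
  exists r, [/\ trace_constant p Omega = r%:E, 0 <= r, q * r * `|alpha| < c &
    exists w G g, [/\ sobolev_trace p Omega w G g, ~ ae_zero Omega w &
      (\int[lebesgue R n]_(x in Omega) (w x)%:E = 0)%E]].
Proof.
move=> c0 q0 a0.
have [[w [G [g [tw nw w0]]]]|none] := pselect (exists w G g,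
    [/\ sobolev_trace p Omega w G g, ~ ae_zero Omega w &
      (\int[lebesgue R n]_(x in Omega) (w x)%:E = 0)%E]); last first.
  have -> : trace_constant p Omega = -oo%E.
    rewrite /trace_constant (_ : [set _ | _] = set0) ?ereal_sup0//.
    apply/seteqP; split => // y [w [G [g [tw nw w0 _]]]]; apply: none.
    by exists w, G, g.
  by rewrite gt0_muleNy ?lte_fin// inveNy -EFinN lt0_muleNy ?lte_fin ?oppr_lt0//.
have C0 : (0 <= trace_constant p Omega)%E.
  apply: (@le_trans _ _ (boundary_integral p Omega g / gradient_integral p Omega G)%E).
    by rewrite mule_ge0 ?inve_ge0 ?integral_ge0// => x _; rewrite lee_fin powR_ge0.
  by apply: ereal_sup_ubound; exists w, G, g.
move: C0; case: (trace_constant p Omega) => [r| |]// C0 h; last first.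
  by move: h; rewrite gt0_muley ?lte_fin// mulr0 ltNge ltW.
exists r; split => //; last by exists w, G, g.
move: h; have [->|r_neq0] := eqVneq r 0; first by rewrite mulr0 mul0r.
have qr : 0 < q * r by rewrite mulr_gt0// lt_def r_neq0.
rewrite -EFinM inver gt_eqF// -EFinN -EFinM lte_fin ltr_pdivrMr// => h.
by rewrite ltr0_norm//; lra.
Qed.

Section Exponent.
Variables (p A D k : R).
Hypotheses (p1 : 1 < p) (split_p : powR_split p A D k).

Let p0 : 0 < p. Proof. exact: lt_trans p1. Qed.

Lemma boundary_integral_real u G g : sobolev_trace p Omega u G g ->
  exists2 b, 0 <= b & boundary_integral p Omega g = b%:E.
Proof.
move=> [_ [[_ gfin] _]]; apply: ge0_lty_real => //.
by apply: integral_ge0 => x _; rewrite lee_fin powR_ge0.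
Qed.

Lemma gradient_integral_real u G g : sobolev_trace p Omega u G g ->
  exists2 gr, 0 <= gr & gradient_integral p Omega G = gr%:E.
Proof.
move=> [uG _]; apply: ge0_lty_real; last exact: gradient_integral_lty uG.
by apply: integral_ge0 => x _; rewrite lee_fin powR_ge0.
Qed.

Lemma integral_lin t (u v : 'rV[R]_n -> R) :
  in_Lp (lebesgue R n) Omega p u -> in_Lp (lebesgue R n) Omega p v ->
  (\int[lebesgue R n]_(x in Omega) (u x + t * v x)%:E =
   \int[lebesgue R n]_(x in Omega) (u x)%:E +
   t%:E * \int[lebesgue R n]_(x in Omega) (v x)%:E)%E.
Proof.
move=> up vp; have ui := in_Lp_integrable mO p1 Ofin up.
have vi := in_Lp_integrable mO p1 Ofin vp.
rewrite -(integralZl mO vi) -(integralD mO ui (integrableZl mO t vi)).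
by apply: eq_integral => x _; rewrite /= -EFinM -EFinD.
Qed.

(* If w = 0 almost everywhere then w does not enter the supremum; instead the
   bound is passed to the limit s -> 0 along w + s v for a fixed admissible v,
   which avoids proving that the trace and the weak gradient are unique. *)
Lemma boundary_le_gradient (r : R) w G g v H h : 0 <= r ->
  trace_constant p Omega = r%:E ->
  sobolev_trace p Omega v H h -> ~ ae_zero Omega v ->
  (\int[lebesgue R n]_(x in Omega) (v x)%:E = 0)%E ->
  sobolev_trace p Omega w G g ->
  (\int[lebesgue R n]_(x in Omega) (w x)%:E = 0)%E ->
  (boundary_integral p Omega g <= r%:E * gradient_integral p Omega G)%E.
Proof.
move=> r0 Cr tv nv v0 tw w0.
have quot w' G' g' : sobolev_trace p Omega w' G' g' -> ~ ae_zero Omega w' ->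
    (\int[lebesgue R n]_(x in Omega) (w' x)%:E = 0)%E ->
    (boundary_integral p Omega g' <= r%:E * gradient_integral p Omega G')%E.
  move=> tw' nw' w'0; have [b b0 Eb] := boundary_integral_real tw'.
  have [gr gr0 Egr] := gradient_integral_real tw'.
  have : (boundary_integral p Omega g' / gradient_integral p Omega G' <= r%:E)%E.
    by rewrite -Cr; apply: ereal_sup_ubound; exists w', G', g'.
  (* The inverse of 0 is +oo, so a vanishing gradient integral forces the boundary integral to
     vanish too, the quotient being at most r. *)
  rewrite Eb Egr inver; case: eqVneq => [->|gr_neq0].
    have [->|b_neq0] := eqVneq b 0; first by rewrite mule0.
    by rewrite gt0_muley ?lte_fin ?lt_def ?b_neq0.
  by rewrite -EFinM !lee_fin ler_pdivrMr// lt_def gr_neq0.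
have [zw|] := pselect (ae_zero Omega w); last by move=> nw; exact: (quot _ _ _ tw nw w0).
have [b b0 Eb] := boundary_integral_real tw.
have [gr gr0 Egr] := gradient_integral_real tw.
have [bh bh0 Ebh] := boundary_integral_real tv.
have [gH gH0 EgH] := gradient_integral_real tv.
rewrite Eb Egr -EFinM lee_fin.
apply: (powR_split_limit split_p p0 r0 gr0 gH0 bh0) => e s e0 s0.
have ts := sobolev_trace_lin openO boundedO p1 s tw tv.
have wp : in_Lp (lebesgue R n) Omega p w by case: tw => -[].
have vp : in_Lp (lebesgue R n) Omega p v by case: tv => -[].
have [bs bs0 Ebs] := boundary_integral_real ts.
have [gs gs0 Egs] := gradient_integral_real ts.
have mG := measurable_sobolev_enorm tw.1; have mH := measurable_sobolev_enorm tv.1.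
have mGH := measurable_sobolev_enorm ts.1.
have mg : measurable_fun (boundary Omega : set (caratheodory_type (hausdorff_om n n.-1))) g.
  by case: tw => _ [[]].
have mh : measurable_fun (boundary Omega : set (caratheodory_type (hausdorff_om n n.-1))) h.
  by case: tv => _ [[]].
have mgh : measurable_fun (boundary Omega : set (caratheodory_type (hausdorff_om n n.-1)))
    (fun x => g x + s * h x) by case: ts => _ [[]].
(* The boundary estimate uses w = (w + s v) - s v, whereas the gradient of w + s v is bounded from
   those of w and v; [quot] for w + s v links the two. *)
exists bs, gs; split.
- rewrite -lee_fin EFinD !(EFinM _ bs) !(EFinM _ bh) -Eb -Ebs -Ebh.
  have -> : s `^ p = `|- s| `^ p by rewrite normrN gtr0_norm.
  apply: (integral_norm_powR_lin _ mB (t := - s) split_p p0 e0 mg mgh mh) => x _.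
  by ring.
- rewrite -lee_fin EFinD !(EFinM _ gr) !(EFinM _ gH) -Egr -Egs -EgH.
  have -> : s `^ p = `|s| `^ p by rewrite gtr0_norm.
  apply: (integral_powR_lin _ mO (t := s) split_p p0 e0 mGH mG mH) => x _;
    do ?exact: enorm_ge0.
  by rewrite -enormZ; exact: enormD.
rewrite -lee_fin EFinM -Ebs -Egs; apply: (quot _ _ _ ts) => [zs|].
(* If w + s v vanished almost everywhere, so would s v, hence v, because s > 0. *)
- apply: nv; apply: ae_imply2 zw zs => x wx wsx Ox.
  have := wsx Ox; rewrite (wx Ox) add0r => /eqP.
  by rewrite mulf_eq0 gt_eqF//= => /eqP.
- by rewrite (integral_lin s wp vp) w0 v0 mule0 adde0.
Qed.

Lemma power_integral_real u : in_Lp (lebesgue R n) Omega p u -> ~ ae_zero Omega u ->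
  exists2 U, 0 < U & power_integral p Omega u = U%:E.
Proof.
move=> [mu ufin] nu; have [U U0 EU] : exists2 U, 0 <= U & power_integral p Omega u = U%:E.
  apply: ge0_lty_real => //.
  by apply: integral_ge0 => x _; rewrite lee_fin powR_ge0.
exists U => //; rewrite lt_def U0 andbT; apply/eqP => U_eq0; apply: nu.
have mn : measurable_fun (Omega : set (caratheodory_type (lebesgue_om n)))
    (fun x => `|u x|) by exact: measurableT_comp.
have mup := measurable_powR_EFin p mn.
have /(ae_eq_integral_abs _ mO mup) :
    (\int[lebesgue R n]_(x in Omega) `|(`|u x| `^ p)%R%:E| = 0)%E.
  rewrite -[RHS]/(0%:E) -U_eq0 -EU; apply: eq_integral => x _.
  by rewrite gee0_abs// lee_fin powR_ge0.
move=> uz; apply: (ae_imply2 _ uz uz) => x ux _ Ox; have /eqP := ux Ox.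
by rewrite /= eqe => /eqP/powR_eq0_eq0/normr0_eq0.
Qed.

(** On a null set the integral of |u|^p would be 0, against [power_integral_real]. *)
Lemma lebesgue_real_gt0 u : in_Lp (lebesgue R n) Omega p u -> ~ ae_zero Omega u ->
  exists2 V, 0 < V & lebesgue R n Omega = V%:E.
Proof.
move=> up nu; have [U U0 EU] := power_integral_real up nu.
have [V V0 EV] : exists2 V, 0 <= V & lebesgue R n Omega = V%:E.
  exact: ge0_lty_real.
exists V => //; rewrite lt_def V0 andbT; apply/eqP => V_eq0.
case: up => mu _.
have mn : measurable_fun (Omega : set (caratheodory_type (lebesgue_om n)))
    (fun x => `|u x|) by exact: measurableT_comp.
have Omega0 : lebesgue R n Omega = 0%E by rewrite EV V_eq0.
have := integral_abs_eq0 mO (measurable_powR_EFin p mn) Omega0.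
under eq_integral do rewrite gee0_abs ?lee_fin ?powR_ge0//.
by rewrite -/(power_integral p Omega u) EU => -[] /eqP; rewrite gt_eqF.
Qed.

Lemma lambda1_lower_bound alpha (r : R) : alpha < 0 -> 0 <= r ->
  trace_constant p Omega = r%:E -> D * `|alpha| * r < 1 ->
  (exists w G g, [/\ sobolev_trace p Omega w G g, ~ ae_zero Omega w &
      (\int[lebesgue R n]_(x in Omega) (w x)%:E = 0)%E]) ->
  (alpha%:E * (surface R n (boundary Omega) / lebesgue R n Omega) *
    (1 + A * (k * `|alpha| * r / (1 - D * `|alpha| * r)) `^ (p - 1)^-1)%:E
   <= lambda1 alpha p Omega)%E.
Proof.
move=> a0 r0 Cr Dar [v [H [h [tv nv v0]]]].
apply: le_ereal_inf_tmp => _ [u [G [g [tu nu ->]]]].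
have up : in_Lp (lebesgue R n) Omega p u by case: tu => -[].
have [U U0 EU] := power_integral_real up nu.
have [V V0 EV] := lebesgue_real_gt0 up nu.
have [A0 D0 k0 _] := split_p.
have fac0 : 0 < 1 + A * (k * `|alpha| * r / (1 - D * `|alpha| * r)) `^ (p - 1)^-1.
  by rewrite ltr_wpDr// mulr_ge0// powR_ge0.
(* An infinite surface measure makes the left-hand side -oo, since alpha < 0 and the other factors
   are positive. *)
have [Sfin|] := ltP (surface R n (boundary Omega)) +oo%E; last first.
  rewrite leye_eq => /eqP ->; rewrite EV inver gt_eqF//.
  by rewrite gt0_mulye ?lte_fin ?invr_gt0// lt0_muley ?lte_fin// gt0_mulNye ?lte_fin ?leNye.
have [S S0 ES] : exists2 S, 0 <= S & surface R n (boundary Omega) = S%:E.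
  exact: ge0_lty_real.
have [b b0 Eb] := boundary_integral_real tu.
have [gr gr0 Egr] := gradient_integral_real tu.
have [m Em] : exists m : R, (\int[lebesgue R n]_(x in Omega) (u x)%:E = m%:E)%E.
  have := integrable_fin_num mO (in_Lp_integrable mO p1 Ofin up).
  by case: (integral _ _ _) => // m _; exists m.
(* The mean value of u; w = u - c is written u + (- c) 1 to match [sobolev_trace_lin]. *)
pose c := m / V.
have tc := sobolev_trace_cst openO boundedO p1 1 Sfin.
have tw := sobolev_trace_lin openO boundedO p1 (- c) tu tc.
have cp : in_Lp (lebesgue R n) Omega p (cst 1) by case: tc => -[].
have w0 : (\int[lebesgue R n]_(x in Omega) (u x + - c * cst 1 x)%:E = 0)%E.
  rewrite (integral_lin (- c) up cp) Em.
  change (m%:E + (- c)%:E * \int[lebesgue R n]_(x in Omega) cst (1%:E : \bar R) x = 0)%E.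
  rewrite (integral_cst _ mO) EV mul1e -EFinM -EFinD /c; congr EFin.
  by field; rewrite gt_eqF.
have := boundary_le_gradient r0 Cr tv nv v0 tw w0.
have [b' b'0 Eb'] := boundary_integral_real tw.
have -> : gradient_integral p Omega (fun x => G x + - c *: cst 0 x) = gr%:E.
  by rewrite -Egr; apply: eq_integral => x _; rewrite scaler0 addr0.
rewrite Eb' -EFinM lee_fin => b'r.
have mean : `|c| `^ p * V <= U.
  rewrite -lee_fin -EU; apply: (powR_mean_le mO p1 up EV).
  by rewrite Em /c divfK// gt_eqF.
have mg : measurable_fun (boundary Omega : set (caratheodory_type (hausdorff_om n n.-1))) g.
  by case: tu => _ [[]].
have mw : measurable_fun (boundary Omega : set (caratheodory_type (hausdorff_om n n.-1)))
   (fun x => g x + - c * cst 1 x) by case: tw => _ [[]].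
have mc : measurable_fun (boundary Omega : set (caratheodory_type (hausdorff_om n n.-1)))
   (cst c) by exact: measurable_cst.
(* On the boundary g = c + (g - c), where g - c is the trace of w: the splitting inequality with t =
   1. *)
have Hb e : 0 < e -> b <= (1 + A * e) * (`|c| `^ p * S) + (D + k * e `^ (1 - p)) * b'.
  move=> e0; rewrite -lee_fin EFinD EFinM (EFinM _ b') -Eb -Eb'.
  have -> : D + k * e `^ (1 - p) = (D + k * e `^ (1 - p)) * `|1| `^ p.
    by rewrite normr1 powR1 mulr1.
  have -> : (`|c| `^ p * S)%:E = boundary_integral p Omega (cst c).
    change ((`|c| `^ p * S)%:E =
      \int[surface R n]_(x in boundary Omega) cst (`|c| `^ p)%R%:E x)%E.
    by rewrite (integral_cst _ mB) ES EFinM.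
  apply: (integral_norm_powR_lin _ mB (t := 1) split_p p0 e0 mg mc mw) => x _.
  by rewrite /=; ring.
have na : 0 < `|alpha| by rewrite normr_gt0 lt_eqF.
have cp0 : 0 <= `|c| `^ p by exact: powR_ge0.
have := quotient_lower_bound split_p p1 na r0 Dar S0 V0 U0 cp0 gr0 mean b'r Hb.
have aN : - `|alpha| = alpha by rewrite ltr0_norm// opprK.
rewrite -[- (`|alpha| * b)]mulNr !aN => le_main.
by rewrite ES EV Eb Egr EU !inver !gt_eqF.
Qed.

End Exponent.

End RobinEigenvalue.

Theorem theorem2p1 (R : realType) (n : nat) (Omega : set 'rV[R]_n)
    (n_ge2 : (2 <= n)%N) (Omega_lip : bounded_lipschitz_domain Omega) :
  [/\ (forall p alpha : R, 2 <= p ->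
         (- (2 `^ (2 - p))%R%:E / (p%:E * trace_constant p Omega)
            < alpha%:E)%E ->
         alpha < 0 ->
         (alpha%:E * (surface R n (boundary Omega) / lebesgue R n Omega) *
            (1 + (2 `^ (p - 2) * (p - 1))%R%:E *
               ((2 `^ (p - 2) * `|alpha|)%R%:E * trace_constant p Omega /
                (1 - (2 `^ (p - 2) * p)%R%:E * trace_constant p Omega *
                     `|alpha|%R%:E)) `^ (p - 1)^-1%R)
          <= lambda1 alpha p Omega)%E),
      (forall p alpha : R, 1 < p -> p <= 2 ->
         (- 1%R%:E / (p%:E * trace_constant p Omega) < alpha%:E)%E ->
         alpha < 0 ->
         (alpha%:E * (surface R n (boundary Omega) / lebesgue R n Omega) *
            (1 + (p - 1)%R%:E *
               (`|alpha|%R%:E * trace_constant p Omega /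
                (1 - p%:E * trace_constant p Omega * `|alpha|%R%:E))
                 `^ (p - 1)^-1%R)
          <= lambda1 alpha p Omega)%E) &
      (forall alpha : R,
         (- 1%R%:E / trace_constant 2%R Omega < alpha%:E)%E ->
         alpha < 0 ->
         (alpha%:E * (surface R n (boundary Omega) / lebesgue R n Omega) *
            (1 + `|alpha|%R%:E * trace_constant 2%R Omega /
                 (1 - trace_constant 2%R Omega * `|alpha|%R%:E))
          <= lambda1 alpha 2%R Omega)%E)].
Proof.
have [_ openO _ boundedO _] := Omega_lip.
split.
- move=> p alpha p2 alpha_gt a0; have p1 : 1 < p by lra.
  have c0 : 0 < 2 `^ (2 - p) :> R by rewrite powR_gt0.
  have p0 : 0 < p by lra.
  have [r [Cr r0 ra ex]] := trace_constant_real c0 p0 a0 alpha_gt.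
  (* Multiplying p C |alpha| < 2^(2-p) by 2^(p-2) turns the range of alpha into D |alpha| C < 1 with
     D = 2^(p-2) p. *)
  have E : 2 `^ (p - 2) * 2 `^ (2 - p) = 1 :> R.
    by rewrite -powRD ?pnatr_eq0 ?implybT// addrA subrK subrr powRr0.
  have Dar : (2 `^ (p - 2) * p) * `|alpha| * r < 1.
    rewrite -[ltRHS]E -!mulrA ltr_pM2l ?powR_gt0//.
    by rewrite [`|alpha| * r]mulrC mulrA.
  apply: le_trans (lambda1_lower_bound openO boundedO p1 (powR_split_ge2 p2) a0 r0 Cr Dar ex).
  rewrite Cr -!EFinM -EFinB inver gt_eqF; last first.
    by rewrite subr_gt0 -mulrA [r * _]mulrC mulrA.
  by rewrite -[2 `^ (p - 2) * p * r * _]mulrA [r * `|alpha|]mulrC mulrA.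
- move=> p alpha p1 p2 alpha_gt a0.
  have p0 : 0 < p by lra.
  have [r [Cr r0 ra ex]] := trace_constant_real ltr01 p0 a0 alpha_gt.
  have Dar : p * `|alpha| * r < 1 by rewrite -mulrA [_ * r]mulrC mulrA.
  apply: le_trans (lambda1_lower_bound openO boundedO p1 (powR_split_le2 p1 p2) a0 r0 Cr Dar ex).
  rewrite Cr -!EFinM -EFinB inver gt_eqF; last first.
    by rewrite subr_gt0 -mulrA [r * _]mulrC mulrA.
  rewrite mul1r.
  by rewrite -[p * r * _]mulrA [r * `|alpha|]mulrC mulrA.
move=> alpha alpha_gt a0; have p1 : 1 < 2 :> R by lra.
(* The factor 1 in front of the constant is the value D = 1 of [powR_split2]. *)
have alpha_gt' : (- 1%:E / (1%:E * trace_constant 2%R Omega) < alpha%:E)%E.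
  by rewrite mul1e.
have [r [Cr r0 ra ex]] := trace_constant_real ltr01 ltr01 a0 alpha_gt'.
have Dar : 1 * `|alpha| * r < 1 by rewrite -mulrA [_ * r]mulrC mulrA.
apply: le_trans (lambda1_lower_bound openO boundedO p1 powR_split2 a0 r0 Cr Dar ex).
have ar0 : 0 <= `|alpha| * r / (1 - `|alpha| * r).
  by rewrite divr_ge0 ?mulr_ge0// subr_ge0 -[`|alpha|]mul1r ltW.
rewrite Cr -!EFinM -EFinB inver gt_eqF; last by rewrite subr_gt0 mulrC -[`|alpha|]mul1r.
rewrite !mul1r [r * _]mulrC.
(* At p = 2 the exponent 1/(p-1) is 1, so the power in the general bound disappears. *)
have -> : (2 - 1)^-1 = 1 :> R by field.
by rewrite powRr1.
Qed.
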